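(* Let $\mathcal{A}=(\mathbf{A}_1,\mathbf{A})$, $\mathcal{B}=(\mathbf{B}_1,\mathbf{B})$ be conic quantum spaces, and let $\psi\in\mathfrak{Z}^2[\mathbf{A}_1]$ and $\varphi\in\mathfrak{Z}^2[\mathbf{B}_1]$ be 2nd $\mathcal{A}$-admissible and 2nd $\mathcal{B}$-admissible, respectively. Then $$\mathcal{A}_\psi\odot\mathcal{B}_\varphi=(\mathcal{A}\odot\mathcal{B})_{\mathfrak{j}(\psi,\varphi)},\qquad \mathcal{A}_\psi\triangleright\mathcal{B}_\varphi=(\mathcal{A}\triangleright\mathcal{B})_{\mathfrak{j}(\psi^!,\varphi)},$$ $$\mathcal{A}_\psi\triangleleft\mathcal{B}_\varphi=(\mathcal{A}\triangleleft\mathcal{B})_{\mathfrak{j}(\psi,\varphi^!)},\qquad \mathcal{A}_\psi\diamond\mathcal{B}_\varphi=(\mathcal{A}\diamond\mathcal{B})_{\mathfrak{j}(\psi,\varphi)^!}.$$ And for quadratic and, more generally, $m$-th quantum spaces $\mathcal{A},\mathcal{B}$, $\mathcal{A}_\psi\bullet\mathcal{B}_\varphi=(\mathcal{A}\bullet\mathcal{B})_{\mathfrak{j}(\psi,\varphi)}$.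
   Context: $\Bbbk$ is $\mathbb{R}$ or $\mathbb{C}$. A quantum space is a pair $\mathcal{A}=(\mathbf{A}_1,\mathbf{A})$ with $\mathbf{A}$ a unital associative $\Bbbk$-algebra generated by a finite-dimensional subspace $\mathbf{A}_1$; $\Pi:\mathbf{A}_1^\otimes\twoheadrightarrow\mathbf{A}$ is the canonical epimorphism. It is conic if $\ker\Pi=\mathbf{I}=\bigoplus_n\mathbf{I}_n$ with $\mathbf{I}_n\subset\mathbf{A}_1^{\otimes n}$; $m$-th ($m\geq 2$; quadratic if $m=2$) if $\ker\Pi$ is generated by a subspace of $\mathbf{A}_1^{\otimes m}$. Quantum spaces with the same generating space and the same ideal are identified. $I[\mathbf{X}]$ denotes the two-sided ideal generated by $\mathbf{X}$, and $\cdot$ the product of subspaces in $\mathbf{A}_1^\otimes$. For $n\ge2$, $\mathbf{I}_n^\perp\subset\mathbf{A}_1^{\ast\otimes n}$ is the annihilator of $\mathbf{I}_n$; $\mathbf{I}_0^\perp=\mathbf{I}_1^\perp=\{0\}$ by convention. Let $\mathcal{A},\mathcal{B}$ be conic with ideals $\bigoplus\mathbf{I}_n$, $\bigoplus\mathbf{J}_n$. With the identification $[\mathbf{V}\otimes\mathbf{W}]^{\otimes}=\bigoplus_n\mathbf{V}^{\otimes n}\otimes\mathbf{W}^{\otimes n}$: $\mathcal{A}\odot\mathcal{B}$ has generators $\mathbf{A}_1\otimes\mathbf{B}_1$ and ideal $\bigoplus_n\mathbf{I}_n\otimes\mathbf{J}_n$; $\mathcal{A}\triangleright\mathcal{B}$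 has generators $\mathbf{A}_1^\ast\otimes\mathbf{B}_1$ and ideal $I[\bigoplus_n\mathbf{I}_n^\perp\otimes\mathbf{J}_n]$; $\mathcal{A}\triangleleft\mathcal{B}$ has generators $\mathbf{A}_1\otimes\mathbf{B}_1^\ast$ and ideal $I[\bigoplus_n\mathbf{I}_n\otimes\mathbf{J}_n^\perp]$; $\mathcal{A}\diamond\mathcal{B}$ has generators $\mathbf{A}_1^\ast\otimes\mathbf{B}_1^\ast$ and ideal $I[\bigoplus_n\mathbf{I}_n^\perp\otimes\mathbf{J}_n^\perp]$. For $m$-th quantum spaces $\mathcal{A},\mathcal{B}$ (same $m$), $\mathcal{A}\bullet\mathcal{B}$ has generators $\mathbf{A}_1\otimes\mathbf{B}_1$ and ideal $I[\mathbf{I}_m\otimes\mathbf{J}_m]$. For a vector space $\mathbf{V}$, $\mathsf{C}^2[\mathbf{V}]$ is the group of linear automorphisms $\psi$ of $\mathbf{V}^\otimes\otimes\mathbf{V}^\otimes$ preserving each $\mathbf{V}^{\otimes r}\otimes\mathbf{V}^{\otimes s}$, with restrictions $\psi_{r,s}$. Identifying $\mathbf{V}^{\otimes r}\otimes\mathbf{V}^{\otimes s}\cong\mathbf{V}^{\otimes r+s}$ by multiplication, $\psi$ is a 2-cocycle if $\psi_{r+s,t}(\psi_{r,s}\otimes id_t)=\psi_{r,s+t}(id_r\otimes\psi_{s,t})$ for all $r,s,t$; counital if $\psi(1\otimes a)=1\otimes a$, $\psi(a\otimes1)=a\otimes1$. $\mathfrak{Z}^2[\mathbf{V}]$ is the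 set of counital 2-cocycles. For finite-dimensional $\mathbf{V}$, $\psi^!=(\psi^{\ast})^{-1}\in\mathsf{C}^2[\mathbf{V}^\ast]$, where $\psi^\ast$ is the transpose under the natural pairing (componentwise $(\psi^\ast)_{r,s}=(\psi_{r,s})^\ast$). $\mathfrak{j}(\psi,\varphi)\in\mathsf{C}^2[\mathbf{V}\otimes\mathbf{W}]$, for $\psi\in\mathsf{C}^2[\mathbf{V}]$, $\varphi\in\mathsf{C}^2[\mathbf{W}]$, is given by $\psi_{r,s}\otimes\varphi_{r,s}$ under the canonical isomorphism $(\mathbf{V}\otimes\mathbf{W})^{\otimes r}\otimes(\mathbf{V}\otimes\mathbf{W})^{\otimes s}\cong(\mathbf{V}^{\otimes r}\otimes\mathbf{V}^{\otimes s})\otimes(\mathbf{W}^{\otimes r}\otimes\mathbf{W}^{\otimes s})$. $\psi\in\mathsf{C}^2[\mathbf{A}_1]$ is $\mathcal{A}$-admissible if $\psi(\ker\Pi^{\otimes2})=\ker\Pi^{\otimes2}$. It is 2nd $\mathcal{A}$-admissible ($\mathcal{A}$ conic; this implies admissible) if for all $p,q,r,s\in\mathbb{N}_0$, $\psi$ maps $\mathbf{A}_1^{\otimes s}\otimes(\mathbf{A}_1^{\otimes p}\cdot\mathbf{I}_q\cdot\mathbf{A}_1^{\otimes r})$ onto itself and $(\mathbf{A}_1^{\otimes p}\cdot\mathbf{I}_q\cdot\mathbf{A}_1^{\otimes r})\otimes\mathbf{A}_1^{\otimes s}$ onto itself. For $\mathcal{A}$-admissible $\psi\in\mathfrak{Z}^2[\mathbf{A}_1]$,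 the twisting $\mathcal{A}_\psi=(\mathbf{A}_1,\mathbf{A}_\psi)$ is the quantum space with $\mathbf{A}_\psi$ the vector space $\mathbf{A}$ with the same unit and product $m_{\mathbf A}\Psi$, where $m_{\mathbf A}$ is the product of $\mathbf{A}$ and $\Psi\,\Pi^{\otimes2}=\Pi^{\otimes2}\psi$; each formula in the claim includes the assertion that the cochain on the right-hand side is a counital 2-cocycle admissible for the indicated quantum space. *)

(* Defs.v *)
From HB Require Import structures.
From mathcomp Require Import all_boot all_algebra finmap.
From mathcomp Require Import boolp classical_sets reals.
From mathcomp Require Import complex monalg.

Set Implicit Arguments.
Unset Strict Implicit.
Unset Printing Implicit Defensive.

Import GRing.Theory.

Local Open Scope classical_set_scope.
Local Open Scope ring_scope.

Variant scalars := RealScalars | ComplexScalars.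

Definition base_field (R : realType) (s : scalars) : fieldType :=
  match s with RealScalars => R | ComplexScalars => R[i] end.

Section LinearExtension.
Context {K : fieldType}.

Section Ext.
Context {G : choiceType} {U : lmodType K} (f : G -> U).

(* The linear map sending the basis vector << g >> to f g. *)
Definition linext (x : {malg K[G]}) : U := \sum_(g <- msupp x) x@_g *: f g.

Lemma linextEw (d : {fset G}) (x : {malg K[G]}) :
  (msupp x `<=` d)%fset -> linext x = \sum_(g <- d) x@_g *: f g.
Proof.
move=> le; rewrite /linext; apply: big_fset_incl => // g gd gx.
by rewrite (mcoeff_outdom gx) scale0r.
Qed.

Lemma linext_is_linear : linear linext.
Proof.
move=> c x y; pose d := (msupp (c *: x + y) `|` (msupp x `|` msupp y))%fset.
rewrite !(@linextEw d) ?fsubsetUl //; last first.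
- by rewrite /d fsetUA fsetUAC fsubsetUr.
- by rewrite /d fsetUA fsubsetUr.
rewrite scaler_sumr -big_split /=; apply: eq_bigr => g _.
by rewrite mcoeffD mcoeffZ scalerDl scalerA.
Qed.

HB.instance Definition _ :=
  GRing.isLinear.Build K {malg K[G]} U _ linext linext_is_linear.

Lemma linextU g : linext << g >> = f g.
Proof.
rewrite (@linextEw [fset g]%fset) ?msuppU_le // big_seq_fset1 mcoeffUU.
by rewrite scale1r.
Qed.

End Ext.

Lemma malg_sum (G : choiceType) (x : {malg K[G]}) :
  x = \sum_(g <- msupp x) x@_g *: << g >>.
Proof.
rewrite {1}[x]monalgE; apply: eq_bigr => g _; apply/malgP => k.
by rewrite mcoeffZ !mcoeffU; case: eqP; rewrite ?mulr1n ?mulr0n ?mulr1 ?mulr0.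
Qed.

Section RawLinear.
Context {U W : lmodType K} (f : U -> W) (lf : linear f).

Let F : {linear U -> W} := HB.pack f (GRing.isLinear.Build K U W _ f lf).

Lemma lin0 : f 0 = 0. Proof. exact: (linear0 F). Qed.
Lemma linD x y : f (x + y) = f x + f y. Proof. exact: (linearD F). Qed.
Lemma linB x y : f (x - y) = f x - f y. Proof. exact: (linearB F). Qed.
Lemma linZ c x : f (c *: x) = c *: f x. Proof. exact: (linearZ_LR F). Qed.
Lemma lin_sum (T : Type) (r : seq T) (P : pred T) (E : T -> U) :
  f (\sum_(i <- r | P i) E i) = \sum_(i <- r | P i) f (E i).
Proof. exact: (linear_sum F). Qed.

End RawLinear.

Lemma malg_eq_lin (G : choiceType) (U : lmodType K)
    (f g : {malg K[G]} -> U) : linear f -> linear g ->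
  (forall k, f << k >> = g << k >>) -> f =1 g.
Proof.
move=> lf lg fg x; rewrite (malg_sum x) (lin_sum lf) (lin_sum lg).
by apply: eq_bigr => k _; rewrite (linZ lf) (linZ lg) fg.
Qed.

(* The bilinear map sending (<< g >>, << h >>) to f g h. *)
Definition linext2 (G H : choiceType) (U : lmodType K) (f : G -> H -> U)
  (x : {malg K[G]}) (y : {malg K[H]}) : U := linext (fun g => linext (f g) y) x.

Section Ext2.
Context {G H : choiceType} {U : lmodType K} (f : G -> H -> U).

Lemma linext2Pl y : linear (linext2 f ^~ y).
Proof. exact: linext_is_linear. Qed.

Lemma linext2Pr x : linear (linext2 f x).
Proof.
move=> c y z; rewrite /linext2 /linext scaler_sumr -big_split /=.
apply: eq_bigr => g _; rewrite -!/(linext (f g) _) linearP /=.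
by rewrite scalerDr !scalerA mulrC.
Qed.

Lemma linext2UU g h : linext2 f << g >> << h >> = f g h.
Proof. by rewrite /linext2 !linextU. Qed.

End Ext2.

(* The tensor product of the free modules on G and H is the free module on
   G * H. *)
Definition tens (G H : choiceType) (x : {malg K[G]}) (y : {malg K[H]}) :
  {malg K[(G * H)%type]} := linext2 (fun g h => << (g, h) >>) x y.

(* The natural pairing of the spaces with dual bases indexed by G. *)
Definition pairing (G : choiceType) (f x : {malg K[G]}) : K :=
  linext2 (U := K^o) (fun g h => (g == h)%:R) f x.

End LinearExtension.

Section Subspaces.
Context {K : fieldType}.

Definition subspace (U : lmodType K) (S : set U) :=
  S 0 /\ forall c x y, S x -> S y -> S (c *: x + y).

Definition lspan (U : lmodType K) (X : set U) : set U := smallest (@subspace U) X.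

Definition sumsp (U : lmodType K) (X : nat -> set U) : set U :=
  lspan (\bigcup_n X n).

Definition tensp (G H : choiceType) (X : set {malg K[G]}) (Y : set {malg K[H]}) :
  set {malg K[(G * H)%type]} := lspan [set tens x y | x in X & y in Y].

Definition mulsp (A : lalgType K) (X Y : set A) : set A :=
  lspan [set x * y | x in X & y in Y].

Definition is_ideal (A : lalgType K) (J : set A) :=
  subspace J /\ forall a x, J x -> J (a * x) /\ J (x * a).

Definition ideal_gen (A : lalgType K) (X : set A) : set A :=
  smallest (@is_ideal A) X.

Section Lspan.
Context {U : lmodType K}.
Implicit Types (S X : set U).

Lemma subspaceD S x y : subspace S -> S x -> S y -> S (x + y).
Proof. by move=> [_ h] /h hx /hx; move=> /(_ 1); rewrite scale1r. Qed.

Lemma subspaceZ S c x : subspace S -> S x -> S (c *: x).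
Proof. by move=> [h0 h] hx; have := h c x 0 hx h0; rewrite addr0. Qed.

Lemma subspaceB S x y : subspace S -> S x -> S y -> S (x - y).
Proof.
move=> hS hx hy; apply: subspaceD => //.
by rewrite -scaleN1r; apply: subspaceZ.
Qed.

Lemma subspace_sum S (T : eqType) (r : seq T) (F : T -> U) :
  subspace S -> (forall i, i \in r -> S (F i)) -> S (\sum_(i <- r) F i).
Proof.
move=> hS; elim: r => [|i r ih] h; first by rewrite big_nil; case: hS.
rewrite big_cons; apply: subspaceD => //; first by apply: h; rewrite mem_head.
by apply: ih => j jr; apply: h; rewrite inE jr orbT.
Qed.

Lemma lspan_subspace X : subspace (lspan X).
Proof.
split=> [M [[]]//|c x y hx hy M [hM XM]].
by case: (hM) => _; apply; [apply: hx|apply: hy].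
Qed.

Lemma sub_lspan X : X `<=` lspan X.
Proof. by move=> x Xx M [_]; apply. Qed.

Lemma lspan_min X S : subspace S -> X `<=` S -> lspan X `<=` S.
Proof. by move=> hS XS x; apply. Qed.

End Lspan.

Lemma lspan_image (U W : lmodType K) (f : U -> W) (X : set U) (S : set W) :
  linear f -> subspace S -> (forall x, X x -> S (f x)) ->
  forall x, lspan X x -> S (f x).
Proof.
move=> lf hS h; apply: (@lspan_min _ _ [set x | S (f x)]) => //; split.
  by rewrite /= (lin0 lf); case: hS.
move=> c x y /= hx hy; rewrite lf; apply: subspaceD => //.
exact: subspaceZ.
Qed.

Lemma ideal_gen_ideal (A : lalgType K) (X : set A) : is_ideal (ideal_gen X).
Proof.
split; first split=> [M [[[]]]//|c x y hx hy M [hM XM]].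
  by case: (hM) => [[_ h] _]; apply: h; [apply: hx|apply: hy].
by move=> a x hx; split=> M [hM XM]; case: (hM) => _ /(_ a x (hx M _))[].
Qed.

Lemma sub_ideal_gen (A : lalgType K) (X : set A) : X `<=` ideal_gen X.
Proof. by move=> x Xx M [_]; apply. Qed.

End Subspaces.

Section Quotient.
Context {K : fieldType} {U : lmodType K} {S : set U} (hS : subspace S).

Definition subspace_pred (_ : subspace S) : U -> bool := fun x => `[< S x >].

Lemma subspace_pred_zmod : zmod_closed (subspace_pred hS).
Proof.
split; first by apply/asboolP; case: hS.
by move=> x y /asboolP hx /asboolP hy; apply/asboolP; apply: subspaceB.
Qed.

HB.instance Definition _ :=
  GRing.isZmodClosed.Build U (subspace_pred hS) subspace_pred_zmod.

Let Q := Quotient.quot (GRing.ZmodClosed.clone U (subspace_pred hS) _).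

Definition lquot : Type := Q.

HB.instance Definition _ := GRing.Zmodule.on lquot.

Definition lpi (x : U) : lquot := (\pi_Q x)%qT.

Definition lrepr (q : lquot) : U := repr (q : Q).

Lemma lreprK q : lpi (lrepr q) = q.
Proof. exact: reprK. Qed.

Lemma lpi_eq x y : lpi x = lpi y <-> S (x - y).
Proof.
split=> [|h]; last apply/eqP.
  by move=> /eqP; rewrite -Quotient.idealrBE => /asboolP.
by rewrite -Quotient.idealrBE; apply/asboolP.
Qed.

Lemma lpiB x y : lpi (x - y) = lpi x - lpi y.
Proof. exact: (raddfB (\pi_Q)%qT). Qed.

Lemma lpiD x y : lpi (x + y) = lpi x + lpi y.
Proof. exact: (raddfD (\pi_Q)%qT). Qed.

Lemma lpi_repr x : S (lrepr (lpi x) - x).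
Proof. by apply/lpi_eq; rewrite lreprK. Qed.

Definition lquot_scale (c : K) (q : lquot) : lquot := lpi (c *: lrepr q).

Lemma lpiZ c x : lpi (c *: x) = lquot_scale c (lpi x).
Proof.
apply/lpi_eq; rewrite -scalerBr; apply: subspaceZ => //.
by apply/lpi_eq; rewrite lreprK.
Qed.

Fact lquot_scaleA a b q :
  lquot_scale a (lquot_scale b q) = lquot_scale (a * b) q.
Proof. by rewrite -[q]lreprK -!lpiZ scalerA. Qed.

Fact lquot_scale1 : left_id 1 lquot_scale.
Proof. by move=> q; rewrite -[q]lreprK -!lpiZ scale1r. Qed.

Fact lquot_scaleDr : right_distributive lquot_scale +%R.
Proof.
by move=> c q r; rewrite -[q]lreprK -[r]lreprK -lpiD -!lpiZ -lpiD scalerDr.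
Qed.

Fact lquot_scaleDl q : {morph lquot_scale^~ q : a b / a + b}.
Proof. by move=> a b; rewrite -[q]lreprK -!lpiZ -lpiD scalerDl. Qed.

HB.instance Definition _ := GRing.Zmodule_isLmodule.Build K lquot
  lquot_scaleA lquot_scale1 lquot_scaleDr lquot_scaleDl.

Lemma lpi_linear : linear lpi.
Proof. by move=> c x y; rewrite lpiD lpiZ. Qed.

Lemma lpi0 x : lpi x = 0 <-> S x.
Proof. by rewrite -(lin0 lpi_linear) lpi_eq subr0. Qed.

End Quotient.

Section TensorProduct.
Context {K : fieldType}.

(* The relations making the basis vectors << (u, w) >> of the free module on
   U * W bilinear in (u, w). *)
Definition bilinear_rels (U W : lmodType K) : set {malg K[(U * W)%type]} :=
  [set t | (exists c u u' w,
              t = << (c *: u + u', w) >> - (c *: << (u, w) >> + << (u', w) >>))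
        \/ (exists c u w w',
              t = << (u, c *: w + w') >> - (c *: << (u, w) >> + << (u, w') >>))].

Definition tensor_product (U W : lmodType K) : lmodType K :=
  lquot (lspan_subspace (bilinear_rels (U := U) (W := W))).

Definition tensor (U W : lmodType K) (u : U) (w : W) : tensor_product U W :=
  lpi (lspan_subspace (@bilinear_rels U W)) << (u, w) >>.

Lemma tensor_linearl (U W : lmodType K) (w : W) : linear ((@tensor U W)^~ w).
Proof.
move=> c u u'; rewrite /tensor -(lpi_linear _ c); apply/lpi_eq.
by apply: sub_lspan; left; exists c, u, u', w.
Qed.

Lemma tensor_linearr (U W : lmodType K) (u : U) : linear (@tensor U W u).
Proof.
move=> c w w'; rewrite /tensor -(lpi_linear _ c); apply/lpi_eq.
by apply: sub_lspan; right; exists c, u, w, w'.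
Qed.

(* The linear map on U (x) W induced by f : U -> W -> X (f bilinear). *)
Definition tensor_lift (U W X : lmodType K) (f : U -> W -> X)
  (t : tensor_product U W) : X :=
  linext (fun p => f p.1 p.2) (lrepr t).

Section Lift.
Context {U W X : lmodType K} {f : U -> W -> X}.
Hypotheses (fl : forall w, linear (f^~ w)) (fr : forall u, linear (f u)).

Lemma linext_rels (t : {malg K[(U * W)%type]}) :
  lspan (@bilinear_rels U W) t -> linext (fun p => f p.1 p.2) t = 0.
Proof.
apply: (@lspan_image _ _ _ (linext (fun p => f p.1 p.2)) _ [set x | x = 0]).
- exact: linext_is_linear.
- by split=> // c x y /= -> ->; rewrite scaler0 addr0.
- move=> x [[c [u [u' [w ->]]]]|[c [u [w [w' ->]]]]];
    rewrite /= linearB linearP /= !linextU /=; apply/eqP; rewrite subr_eq0.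
  + by rewrite (fl w).
  + by rewrite (fr u).
Qed.

Lemma tensor_lift_pi t : tensor_lift f (lpi (lspan_subspace (@bilinear_rels U W)) t)
  = linext (fun p => f p.1 p.2) t.
Proof.
apply/eqP; rewrite -subr_eq0 /tensor_lift -linearB; apply/eqP.
by apply: linext_rels; apply: lpi_repr.
Qed.

Lemma tensor_liftE u w : tensor_lift f (tensor u w) = f u w.
Proof. by rewrite tensor_lift_pi linextU. Qed.

Lemma tensor_lift_linear : linear (tensor_lift f).
Proof.
move=> c s t; rewrite -[s]lreprK -[t]lreprK -(lpi_linear _ c).
by rewrite !tensor_lift_pi linearP.
Qed.

End Lift.

Lemma tensor_prod_ext (U W X : lmodType K) (f g : tensor_product U W -> X) :
  linear f -> linear g -> (forall u w, f (tensor u w) = g (tensor u w)) ->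
  f =1 g.
Proof.
move=> lf lg fg t; rewrite -[t]lreprK; move: (lrepr t).
by apply: malg_eq_lin => [c x y|c x y|[u w]];
  rewrite ?(lpi_linear _ c) ?lf ?lg //; apply: fg.
Qed.

End TensorProduct.

(* The tensor algebra V^(x) of a vector space V with a basis indexed by I is the
   free algebra on I: words are the pure tensors of basis vectors.  V^* is given
   the dual basis, also indexed by I, and V (x) W the product basis. *)
Notation tensor_alg K I := {malg K[{fmonom I}]}.
Notation tensor_alg2 K I := {malg K[({fmonom I} * {fmonom I})%type]}.

Section Graded.
Context {K : fieldType} {I : finType}.
Local Notation T := (tensor_alg K I).
Local Notation TT := (tensor_alg2 K I).

(* V^{(x) n} as a subspace of the tensor algebra. *)
Definition Tdeg (n : nat) : set T :=
  [set x | forall w, w \in msupp x -> fdeg w = n].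

(* V^{(x) r} (x) V^{(x) s}. *)
Definition TTdeg (r s : nat) : set TT :=
  [set t | forall p, p \in msupp t -> fdeg p.1 = r /\ fdeg p.2 = s].

Definition tmul : TT -> T := 
  linext (fun p : {fmonom I} * {fmonom I} => << mmul p.1 p.2 >> : T).

Definition C2 : set (TT -> TT) :=
  [set psi | [/\ linear psi, bijective psi &
     forall r s, psi @` TTdeg r s = TTdeg r s]].

(* psi(x (x) y) for x, y homogeneous of degrees r, s, read in V^{(x) (r + s)}
   through the multiplication. *)
Definition cochain_mul (psi : TT -> TT) (x y : T) : T := tmul (psi (tens x y)).

Definition cocycle (psi : TT -> TT) :=
  forall r s t x y z, Tdeg r x -> Tdeg s y -> Tdeg t z ->
    cochain_mul psi (cochain_mul psi x y) z =
    cochain_mul psi x (cochain_mul psi y z).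

Definition counital (psi : TT -> TT) :=
  forall x : T, psi (tens 1 x) = tens 1 x /\ psi (tens x 1) = tens x 1.

Definition Z2 : set (TT -> TT) :=
  [set psi | [/\ C2 psi, cocycle psi & counital psi]].

Definition hcomp (n : nat) : T -> T :=
  linext (fun w : {fmonom I} => if fdeg w == n then << w >> : T else 0).

End Graded.

Arguments cochain_mul {K I} psi x y.

Section Duality.
Context {K : fieldType} {I : finType}.
Local Notation T := (tensor_alg K I).
Local Notation TT := (tensor_alg2 K I).

(* A choice of preimage, i.e. the inverse map when f is bijective. *)
Definition inverse (U : choiceType) (x0 : U) (f : U -> U) (y : U) : U :=
  xget x0 [set x | f x = y].

(* The transpose psi^* of psi, for the natural pairing. *)
Definition transpose (psi : TT -> TT) (f : TT) : TT :=
  xget 0 [set g | forall t, pairing g t = pairing f (psi t)].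

(* psi^! = (psi^* )^{-1}. *)
Definition bang (psi : TT -> TT) : TT -> TT := inverse 0 (transpose psi).

(* The annihilator in V^{* (x) n} of a subspace of V^{(x) n}, with the
   convention in degrees 0 and 1. *)
Definition annihilator (n : nat) (X : set T) : set T :=
  if (2 <= n)%N then [set f | Tdeg n f /\ forall x, X x -> pairing f x = 0]
  else [set 0].

End Duality.

Section Shuffle.
Context {K : fieldType} {I J : finType}.

Definition fzip (u : {fmonom I}) (v : {fmonom J}) : {fmonom (I * J)%type} :=
  FMonom (zip u v).

(* The isomorphism V^{(x) n} (x) W^{(x) n} -> (V (x) W)^{(x) n}; only used on
   elements x, y of the same degree. *)
Definition shuffle (x : tensor_alg K I) (y : tensor_alg K J) :
  tensor_alg K (I * J)%type := linext2 (fun u v => << fzip u v >> : tensor_alg K (I * J)%type) x y.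

Definition shuffle_sp (X : set (tensor_alg K I)) (Y : set (tensor_alg K J)) :
  set (tensor_alg K (I * J)%type) := lspan [set shuffle x y | x in X & y in Y].

(* The isomorphism (V^r (x) V^s) (x) (W^r (x) W^s) ->
   (V (x) W)^r (x) (V (x) W)^s of tensor powers, in each bidegree (r, s). *)
Definition shuffle2 (x : tensor_alg2 K I) (y : tensor_alg2 K J) :
  tensor_alg2 K (I * J)%type :=
  linext2 (fun p q => << (fzip p.1 q.1, fzip p.2 q.2) >> :
    tensor_alg2 K (I * J)%type) x y.

(* j(psi, phi): the basis vector z is the image under shuffle2 of the pair of
   basis vectors read off from its first and second letters. *)
Definition jmap (psi : tensor_alg2 K I -> tensor_alg2 K I)
    (phi : tensor_alg2 K J -> tensor_alg2 K J) :
    tensor_alg2 K (I * J)%type -> tensor_alg2 K (I * J)%type :=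
  linext (fun z : {fmonom (I * J)%type} * {fmonom (I * J)%type} =>
    shuffle2 (psi << (FMonom (unzip1 z.1), FMonom (unzip1 z.2)) >>)
             (phi << (FMonom (unzip2 z.1), FMonom (unzip2 z.2)) >>)).

End Shuffle.

(* A quantum space (A_1, A): the finite-dimensional subspace A_1 that generates
   the algebra A is given by a basis qgen, which may be any basis of A_1. *)
Record qspace (K : fieldType) (I : finType) := QSpace {
  qalg :> algType K;
  qgen : I -> qalg;
  qgen_free : forall c : I -> K,
    \sum_i c i *: qgen i = 0 -> forall i, c i = 0;
  qgen_generates : forall S : {pred qalg}, GRing.subalg_closed S ->
    (forall i, qgen i \in S) -> forall a, a \in S }.

Section QuantumSpaces.
Context {K : fieldType} {I : finType}.
Local Notation T := (tensor_alg K I).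
Local Notation TT := (tensor_alg2 K I).
Implicit Type A : qspace K I.

(* The canonical epimorphism Pi; its tensor square canon2 takes values in the
   genuine tensor product of A with itself. *)
Definition canon A : T -> A := linext (fun w : {fmonom I} => \prod_(i <- w) qgen A i).

Definition canon2 A : TT -> tensor_product A A :=
  linext (fun p : {fmonom I} * {fmonom I} =>
    tensor (canon A << p.1 >>) (canon A << p.2 >>)).

Definition qideal A : set T := [set x | canon A x = 0].

(* Quantum spaces with the same generating space and the same ideal are
   identified. *)
Definition same_qspace A A' := qideal A = qideal A'.

(* The homogeneous part I_n of the ideal. *)
Definition hideal A (n : nat) : set T := qideal A `&` Tdeg n.

(* The sum of the X n is direct, because X n lies in degree n. *)
Definition conic A := exists X : nat -> set T,
  (forall n, subspace (X n) /\ X n `<=` Tdeg n) /\ qideal A = sumsp X.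

Definition mth (m : nat) A := (2 <= m)%N /\ exists X : set T,
  [/\ subspace X, X `<=` Tdeg m & qideal A = ideal_gen X].

Definition ker2 A : set TT := [set t | canon2 A t = 0].

Definition admissible A (psi : TT -> TT) := psi @` ker2 A = ker2 A.

Definition admissible2 A (psi : TT -> TT) := forall p q r s,
  let X := mulsp (mulsp (Tdeg p) (hideal A q)) (Tdeg r) in
  psi @` tensp (Tdeg s) X = tensp (Tdeg s) X /\
  psi @` tensp X (Tdeg s) = tensp X (Tdeg s).

(* The map Psi with Psi o Pi^{(x) 2} = Pi^{(x) 2} o psi, for admissible psi. *)
Definition twist_map A (psi : TT -> TT) (t : tensor_product A A) :
  tensor_product A A := canon2 A (psi (xget 0 [set x | canon2 A x = t])).

Definition twist_mul A (psi : TT -> TT) (a b : A) : A :=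
  tensor_lift *%R (twist_map psi (tensor a b)).

End QuantumSpaces.

Section FreeAlgebraTheory.
Context {K : fieldType}.

Lemma tens_linearl (G H : choiceType) (y : {malg K[H]}) :
  linear (fun x : {malg K[G]} => tens x y).
Proof. exact: linext2Pl. Qed.

Lemma tens_linearr (G H : choiceType) (x : {malg K[G]}) :
  linear (fun y : {malg K[H]} => tens x y).
Proof. exact: linext2Pr. Qed.

Lemma tensUU (G H : choiceType) (g : G) (h : H) :
  tens << g >> << h >> = << (g, h) >> :> {malg K[(G * H)%type]}.
Proof. exact: linext2UU. Qed.

Lemma lin_comp (U V W : lmodType K) (g : V -> W) (f : U -> V) :
  linear g -> linear f -> linear (fun x => g (f x)).
Proof. by move=> lg lf c x y; rewrite lf lg. Qed.

Lemma lin_id (U : lmodType K) : linear (fun x : U => x).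
Proof. by []. Qed.

Context {I : finType}.
Local Notation T := (tensor_alg K I).
Local Notation TT := (tensor_alg2 K I).

Lemma malg_mulUU (u v : {fmonom I}) : << u >> * << v >> = << mmul u v >> :> T.
Proof. by rewrite malgM_def fgmulUU mulr1. Qed.

Lemma malg_scalerAr c (x y : T) : x * (c *: y) = c *: (x * y).
Proof.
apply/malgP => k; rewrite mcoeffZ (mcoeffMlw _ (fsubset_refl _) (msuppZ_le _ _)).
rewrite mcoeffMl mulr_sumr; apply: eq_bigr => u _; rewrite mulr_sumr.
by apply: eq_bigr => v _; rewrite mcoeffZ mulrnAr mulrCA.
Qed.

Lemma malg_mull_linear (y : T) : linear (fun x => x * y).
Proof. by move=> c x x'; rewrite mulrDl -scalerAl. Qed.

Lemma malg_mulr_linear (x : T) : linear (fun y => x * y).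
Proof. by move=> c y y'; rewrite mulrDr malg_scalerAr. Qed.

Lemma malg_bilin_ext (G H : choiceType) (U : lmodType K)
    (f g : {malg K[G]} -> {malg K[H]} -> U) :
  (forall y, linear (f^~ y)) -> (forall x, linear (f x)) ->
  (forall y, linear (g^~ y)) -> (forall x, linear (g x)) ->
  (forall u v, f << u >> << v >> = g << u >> << v >>) ->
  forall x y, f x y = g x y.
Proof.
move=> fl fr gl gr h x y; move: x.
apply: (malg_eq_lin (fl y) (gl y)) => u.
by apply: (malg_eq_lin (fr _) (gr _)) y => v.
Qed.

Lemma tmul_linear : linear (@tmul K I).
Proof. exact: linext_is_linear. Qed.

Lemma tmul_tens (x y : T) : tmul (tens x y) = x * y.
Proof.
move: x y; apply: malg_bilin_ext.
- by move=> y; apply: lin_comp; [apply: tmul_linear|apply: tens_linearl].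
- by move=> y; apply: lin_comp; [apply: tmul_linear|apply: tens_linearr].
- exact: malg_mull_linear.
- exact: malg_mulr_linear.
- by move=> u v; rewrite tensUU /tmul linextU malg_mulUU.
Qed.

Lemma hcomp_linear n : linear (@hcomp K I n).
Proof. exact: linext_is_linear. Qed.

Lemma hcompE n (x : T) w : (hcomp n x)@_w = if fdeg w == n then x@_w else 0.
Proof.
rewrite /hcomp /linext raddf_sum /=.
under eq_bigr => g _ do rewrite mcoeffZ.
rewrite [in RHS](malg_sum x) raddf_sum /=.
under [in RHS]eq_bigr => g _ do rewrite mcoeffZ mcoeffU1.
case: ifP => [/eqP wn|wn].
  apply: eq_bigr => g _; case: eqVneq => [gn|gn]; first by rewrite mcoeffU1.
  rewrite mcoeff0; case: eqP => // gw; by rewrite gw wn eqxx in gn.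
rewrite big1 // => g _; case: eqP => gn; last by rewrite mcoeff0 mulr0.
rewrite mcoeffU1; case: eqP => [gw|]; last by rewrite mulr0.
by rewrite -gw gn eqxx in wn.
Qed.

Lemma TdegP n (x : T) : Tdeg n x <-> forall w, fdeg w != n -> x@_w = 0.
Proof.
split=> h w.
  by move=> wn; apply/mcoeff_outdom; apply/negP => /h/eqP; apply/negP.
rewrite -mcoeff_neq0 => xw; apply/eqP; apply: contraNT xw => /h ->.
by rewrite eqxx.
Qed.

Lemma Tdeg_hcomp n (x : T) : Tdeg n (hcomp n x).
Proof. by apply/TdegP => w /negPf wn; rewrite hcompE wn. Qed.

Lemma hcomp_Tdeg m n (x : T) : Tdeg n x -> hcomp m x = if m == n then x else 0.
Proof.
move=> /TdegP xn; apply/malgP => w; rewrite hcompE.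
case: (eqVneq m n) => [->|mn]; first by case: (eqVneq (fdeg w) n) => // /xn ->.
rewrite mcoeff0; case: (eqVneq (fdeg w) m) => // wm.
by rewrite xn // wm.
Qed.

Lemma Tdeg_subspace n : subspace (@Tdeg K I n).
Proof.
split; first by apply/TdegP => w _; rewrite mcoeff0.
move=> c x y /TdegP hx /TdegP hy; apply/TdegP => w wn.
by rewrite mcoeffD mcoeffZ hx ?hy // mulr0 addr0.
Qed.

Lemma TdegU (w : {fmonom I}) : Tdeg (fdeg w) (<< w >> : T).
Proof. by move=> v; rewrite msuppU1 inE => /eqP ->. Qed.

Lemma lin_in (G : choiceType) (U : lmodType K) (f : {malg K[G]} -> U)
    (S : set U) x : linear f -> subspace S ->
  (forall u, u \in msupp x -> S (f << u >>)) -> S (f x).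
Proof.
move=> lf hS h; rewrite (malg_sum x) (lin_sum lf).
by apply: subspace_sum => // u ux; rewrite (linZ lf); apply: subspaceZ => //; apply: h.
Qed.

Lemma TdegM m n (x y : T) : Tdeg m x -> Tdeg n y -> Tdeg (m + n) (x * y).
Proof.
move=> hx hy.
apply: (lin_in (malg_mull_linear y) (Tdeg_subspace _)) => u /hx <-.
apply: (lin_in (malg_mulr_linear _) (Tdeg_subspace _)) => v /hy <-.
by rewrite malg_mulUU -fdegM; apply: TdegU.
Qed.

Lemma hcomp_sum (x : T) :
  exists N, x = \sum_(n < N) hcomp n x.
Proof.
exists (\max_(w <- msupp x) (fdeg w).+1)%N; apply/malgP => w.
rewrite raddf_sum /=; under eq_bigr => n _ do rewrite hcompE.
have [xw|xw] := boolP (w \in msupp x); last first.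
  by rewrite (mcoeff_outdom xw) big1 // => n _; case: ifP.
have lt : (fdeg w < \max_(w <- msupp x) (fdeg w).+1)%N.
  exact: (@leq_bigmax_seq _ _ xpredT (fun w : {fmonom I} => (fdeg w).+1) w).
rewrite (bigD1 (Ordinal lt)) //= eqxx big1 ?addr0 // => n /eqP nw.
by case: eqP => // wn; case: nw; apply: val_inj.
Qed.

Lemma TTdegU (u v : {fmonom I}) : TTdeg (fdeg u) (fdeg v) (<< (u, v) >> : TT).
Proof. by move=> p /(fsubsetP msuppU_le); rewrite inE => /eqP ->. Qed.

Lemma TTdeg_subspace r s : subspace (@TTdeg K I r s).
Proof.
split; first by move=> p; rewrite msupp0 inE.
move=> c x y hx hy p /(fsubsetP (msuppD_le _ _)); rewrite inE => /orP[|/hy//].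
by move=> /(fsubsetP (msuppZ_le _ _))/hx.
Qed.

Lemma TTdeg_tens r s (x y : T) : Tdeg r x -> Tdeg s y -> TTdeg r s (tens x y).
Proof.
move=> hx hy.
apply: (lin_in (tens_linearl y) (@TTdeg_subspace _ _)) => u /hx <-.
apply: (lin_in (tens_linearr _) (@TTdeg_subspace _ _)) => v /hy <-.
by rewrite tensUU; apply: TTdegU.
Qed.

Lemma Tdeg_tmul r s (t : TT) : TTdeg r s t -> Tdeg (r + s) (tmul t).
Proof.
move=> ht; apply: (lin_in tmul_linear (Tdeg_subspace _)) => [[u v]] /ht[/= <- <-].
by rewrite /tmul linextU /= -fdegM; apply: TdegU.
Qed.

End FreeAlgebraTheory.

Arguments TdegU {K I} w.
Arguments TTdegU {K I} u v.
Arguments Tdeg_hcomp {K I} n x.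

Section QuantumSpaceTheory.
Context {K : fieldType} {I : finType} (A : qspace K I).
Local Notation T := (tensor_alg K I).
Local Notation TT := (tensor_alg2 K I).

Lemma canon_linear : linear (canon A).
Proof. exact: linext_is_linear. Qed.

Lemma canonU (w : {fmonom I}) : canon A << w >> = \prod_(i <- w) qgen A i.
Proof. exact: linextU. Qed.

Lemma canon1 : canon A 1 = 1.
Proof. by rewrite -[1 in LHS]/(<< mone >> : T) canonU fm1 big_nil. Qed.

Lemma mull_linear (B : algType K) (b : B) : linear (fun a : B => a * b).
Proof. by move=> c x y; rewrite mulrDl scalerAl. Qed.

Lemma mulr_linear (B : algType K) (a : B) : linear (fun b : B => a * b).
Proof. by move=> c x y; rewrite mulrDr scalerAr. Qed.

Lemma canonM x y : canon A (x * y) = canon A x * canon A y.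
Proof.
move: x y; apply: malg_bilin_ext.
- by move=> y; apply: lin_comp; [apply: canon_linear|apply: malg_mull_linear].
- by move=> x; apply: lin_comp; [apply: canon_linear|apply: malg_mulr_linear].
- move=> y; apply: (@lin_comp _ _ _ _ (fun a => a * canon A y)).
    exact: mull_linear.
  exact: canon_linear.
- by move=> x; apply: lin_comp; [apply: mulr_linear|apply: canon_linear].
by move=> u v; rewrite malg_mulUU !canonU fmM big_cat.
Qed.

Lemma canon_gen i : canon A << fmu i >> = qgen A i.
Proof. by rewrite canonU fmU big_seq1. Qed.

Lemma canon_surj a : exists x, canon A x = a.
Proof.
have := @qgen_generates _ _ A (fun a => `[< exists x, canon A x = a >]).
move=> /(_ _ _ a)/asboolP; apply.
- split; first by apply/asboolP; exists 1; rewrite canon1.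
    move=> c _ _ /asboolP[x <-] /asboolP[y <-]; apply/asboolP.
    by exists (c *: x + y); rewrite canon_linear.
  move=> _ _ /asboolP[x <-] /asboolP[y <-]; apply/asboolP.
  by exists (x * y); rewrite canonM.
- by move=> i; apply/asboolP; exists << fmu i >>; rewrite canon_gen.
Qed.

Lemma canon2_linear : linear (canon2 A).
Proof. exact: linext_is_linear. Qed.

Lemma canon2_tens x y : canon2 A (tens x y) = tensor (canon A x) (canon A y).
Proof.
move: x y; apply: malg_bilin_ext.
- by move=> y; apply: lin_comp; [apply: canon2_linear|apply: tens_linearl].
- by move=> x; apply: lin_comp; [apply: canon2_linear|apply: tens_linearr].
- move=> y; apply: (@lin_comp _ _ _ _ (fun a => tensor a (canon A y))).
    exact: tensor_linearl.
  exact: canon_linear.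
- by move=> x; apply: lin_comp; [apply: tensor_linearr|apply: canon_linear].
by move=> u v; rewrite tensUU /canon2 linextU.
Qed.

Lemma canon2_mul t : tensor_lift *%R (canon2 A t) = canon A (tmul t).
Proof.
apply: (malg_eq_lin (f := fun t => tensor_lift *%R (canon2 A t))
                    (g := fun t => canon A (tmul t))).
- apply: lin_comp; last exact: canon2_linear.
  by apply: tensor_lift_linear; [apply: mull_linear|apply: mulr_linear].
- by apply: lin_comp; [apply: canon_linear|apply: tmul_linear].
move=> [u v]; rewrite -tensUU canon2_tens tensor_liftE.
- by rewrite tmul_tens canonM.
- exact: mull_linear.
- exact: mulr_linear.
Qed.

Lemma qideal_subspace : subspace (qideal A).
Proof.
split; first exact: (lin0 canon_linear).
by move=> c x y /= hx hy; rewrite /qideal /= canon_linear hx hy scaler0 addr0.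
Qed.

Lemma qideal_ideal : is_ideal (qideal A).
Proof.
split; first exact: qideal_subspace.
by move=> a x hx; split; rewrite /qideal /mkset canonM hx ?mulr0 ?mul0r.
Qed.

Lemma ker2_subspace : subspace (ker2 A).
Proof.
split; first exact: (lin0 canon2_linear).
by move=> c x y /= hx hy; rewrite /ker2 /= canon2_linear hx hy scaler0 addr0.
Qed.

Lemma hideal0 x : hideal A 0 x -> x = 0.
Proof.
move=> [hx /TdegP x0].
have e : x = x@_mone *: 1.
  apply/malgP => w; rewrite mcoeffZ mcoeff1.
  have [->|w1] := eqVneq w mone; first by rewrite mulr1.
  by rewrite mulr0 x0 // fdeg_eq0.
move: hx; rewrite /qideal /= e (linZ canon_linear) canon1 => /eqP.
by rewrite scaler_eq0 oner_eq0 orbF => /eqP ->; rewrite scale0r.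
Qed.

Lemma Tdeg1_sum (x : T) : Tdeg 1 x -> x = \sum_i x@_(fmu i) *: << fmu i >>.
Proof.
move=> /TdegP x1; apply/malgP => w; rewrite raddf_sum /=.
under eq_bigr => i _ do rewrite mcoeffZ mcoeffU1.
have [w1|w1] := eqVneq (fdeg w) 1%N; last first.
  rewrite x1 // big1 // => i _; case: eqP => [iw|]; last by rewrite mulr0.
  by rewrite -iw fdegU eqxx in w1.
have [i ->] : exists i, w = fmu i.
  case: w w1 => [[|i [|//]]]//= _; exists i; apply/eqP.
  by rewrite fmP fmU.
rewrite (bigD1 i) //= eqxx mulr1 big1 ?addr0 // => j ji.
case: eqP => [/eqP|]; last by rewrite mulr0.
by rewrite fmP !fmU => /eqP[] ij; rewrite ij eqxx in ji.
Qed.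

Lemma hideal1 x : hideal A 1 x -> x = 0.
Proof.
move=> [hx /Tdeg1_sum e]; rewrite e big1 // => i _.
rewrite (@qgen_free _ _ A (fun i => x@_(fmu i))) ?scale0r //.
rewrite -[RHS]hx [X in _ = canon A X]e (lin_sum canon_linear).
by apply: eq_bigr => j _; rewrite (linZ canon_linear) canon_gen.
Qed.

Lemma conicP : conic A <-> forall n x, qideal A x -> qideal A (hcomp n x).
Proof.
split=> [[X [hX e]] n x|h].
  rewrite [in X in X -> _]e; apply: lspan_image; [exact: hcomp_linear|exact: qideal_subspace|].
  move=> y [m _ yX]; have [_ /(_ _ yX)/hcomp_Tdeg ->] := hX m.
  case: ifP => _; last by case: qideal_subspace.
  by rewrite e; apply: sub_lspan; exists m.
exists (hideal A); split.
  move=> n; split; last by move=> x [].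
  split; first by split; [case: qideal_subspace|case: (@Tdeg_subspace K I n)].
  move=> c x y [hx nx] [hy ny]; split.
    by case: qideal_subspace => _; apply.
  by case: (@Tdeg_subspace K I n) => _; apply.
apply/seteqP; split.
  move=> x hx; have [N e] := hcomp_sum x; rewrite e.
  apply: subspace_sum; first exact: lspan_subspace.
  move=> n _; apply: sub_lspan; exists n => //; split; first exact: h.
  exact: Tdeg_hcomp.
by apply: lspan_min; [exact: qideal_subspace|move=> x [n _ []]].
Qed.

End QuantumSpaceTheory.

Section Twisting.
Context {K : fieldType} {I : finType} (A : qspace K I).
Local Notation T := (tensor_alg K I).
Local Notation TT := (tensor_alg2 K I).
Context {psi : TT -> TT} (Zpsi : Z2 psi) (Apsi : admissible A psi).

Let psi_linear : linear psi. Proof. by case: Zpsi => [[]]. Qed.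

Lemma cochain_mul_linearl y : linear (cochain_mul psi ^~ y).
Proof.
apply: lin_comp; first exact: tmul_linear.
by apply: lin_comp; [exact: psi_linear|exact: tens_linearl].
Qed.

Lemma cochain_mul_linearr x : linear (cochain_mul psi x).
Proof.
apply: lin_comp; first exact: tmul_linear.
by apply: lin_comp; [exact: psi_linear|exact: tens_linearr].
Qed.

Lemma TTdeg_psi r s t : TTdeg r s t -> TTdeg r s (psi t).
Proof. by case: Zpsi => [[_ _ e] _ _] h; rewrite -(e r s); exists t. Qed.

Lemma Tdeg_cochain_mul r s x y :
  Tdeg r x -> Tdeg s y -> Tdeg (r + s) (cochain_mul psi x y).
Proof. by move=> hx hy; apply/Tdeg_tmul/TTdeg_psi/TTdeg_tens. Qed.

Lemma cochain_mulA x y z :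
  cochain_mul psi (cochain_mul psi x y) z = cochain_mul psi x (cochain_mul psi y z).
Proof.
have mL := cochain_mul_linearl; have mR := cochain_mul_linearr.
pose L x y z := cochain_mul psi (cochain_mul psi x y) z.
pose R x y z := cochain_mul psi x (cochain_mul psi y z).
rewrite -[LHS]/(L x y z) -[RHS]/(R x y z).
move: x; apply: malg_eq_lin => [||u].
- by rewrite /L; apply: (lin_comp (mL _) (mL _)).
- by rewrite /R; apply: mL.
move: y; apply: malg_eq_lin => [||v].
- by rewrite /L; apply: (lin_comp (mL _) (mR _)).
- by rewrite /R; apply: (lin_comp (mR _) (mL _)).
move: z; apply: malg_eq_lin => [||w].
- by rewrite /L; apply: mR.
- by rewrite /R; apply: (lin_comp (mR _) (mR _)).
by case: Zpsi => _ cpsi _; apply: cpsi; apply: TdegU.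
Qed.

Lemma cochain_mul1l x : cochain_mul psi 1 x = x.
Proof.
by case: Zpsi => _ _ /(_ x)[e _]; rewrite /cochain_mul e tmul_tens mul1r.
Qed.

Lemma cochain_mul1r x : cochain_mul psi x 1 = x.
Proof.
by case: Zpsi => _ _ /(_ x)[_ e]; rewrite /cochain_mul e tmul_tens mulr1.
Qed.

Lemma twist_mapE t : twist_map psi (canon2 A t) = canon2 A (psi t).
Proof.
have Pt : [set x | canon2 A x = canon2 A t] t := erefl.
rewrite /twist_map; case: xgetP => [y _ e|h]; last by case: (h t Pt).
rewrite /mkset in e; apply/eqP; rewrite -subr_eq0 -(linB (@canon2_linear _ _ A)) -(linB psi_linear).
have : ker2 A (y - t).
  by rewrite /ker2 /= (linB (@canon2_linear _ _ A)) e subrr.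
move=> h; have : ker2 A (psi (y - t)) by rewrite -Apsi; exists (y - t).
by move/eqP.
Qed.

Lemma twist_mulE x y :
  twist_mul psi (canon A x) (canon A y) = canon A (cochain_mul psi x y).
Proof. by rewrite /twist_mul -canon2_tens twist_mapE canon2_mul. Qed.

Definition twist_alg (_ : Z2 psi) (_ : admissible A psi) : Type := qalg A.

Local Notation B := (twist_alg Zpsi Apsi).

HB.instance Definition _ := GRing.Lmodule.on B.

Definition twist_alg_mul : B -> B -> B := @twist_mul K I A psi.
Local Notation mulB := twist_alg_mul.

Fact twist_mulA : associative mulB.
Proof.
move=> a b c; have [x <-] := canon_surj a; have [y <-] := canon_surj b.
by have [z <-] := canon_surj c; rewrite /twist_alg_mul !twist_mulE cochain_mulA.
Qed.

Fact twist_mul1 : left_id (1 : A) mulB.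
Proof.
move=> a; have [x <-] := canon_surj a.
by rewrite -(canon1 A) /twist_alg_mul twist_mulE cochain_mul1l.
Qed.

Fact twist_mulr1 : right_id (1 : A) mulB.
Proof.
move=> a; have [x <-] := canon_surj a.
by rewrite -(canon1 A) /twist_alg_mul twist_mulE cochain_mul1r.
Qed.

Fact twist_mull_linear (b : B) : linear (mulB^~ b).
Proof.
move=> k a a'; have [x <-] := canon_surj a; have [x' <-] := canon_surj a'.
have [y <-] := canon_surj b; rewrite -canon_linear /twist_alg_mul !twist_mulE.
by rewrite cochain_mul_linearl canon_linear.
Qed.

Fact twist_mulr_linear (a : B) : linear (mulB a).
Proof.
move=> k b b'; have [x <-] := canon_surj a; have [y <-] := canon_surj b.
have [y' <-] := canon_surj b'; rewrite -canon_linear /twist_alg_mul !twist_mulE.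
by rewrite cochain_mul_linearr canon_linear.
Qed.

Fact twist_mulDl : left_distributive mulB +%R.
Proof. by move=> a b c; rewrite (linD (twist_mull_linear c)). Qed.

Fact twist_mulDr : right_distributive mulB +%R.
Proof. by move=> a b c; rewrite (linD (twist_mulr_linear a)). Qed.

Fact twist_1_neq0 : (1 : A) != 0 :> B.
Proof. exact: oner_neq0. Qed.

HB.instance Definition _ := GRing.Zmodule_isNzRing.Build B
  twist_mulA twist_mul1 twist_mulr1 twist_mulDl twist_mulDr twist_1_neq0.

Lemma twist_mulrE (a b : B) : a * b = twist_mul psi a b. Proof. by []. Qed.

Fact twist_scaleAl k (a b : B) : k *: (a * b) = (k *: a : B) * b.
Proof. exact/esym/(linZ (twist_mull_linear b)). Qed.

HB.instance Definition _ := GRing.Lmodule_isLalgebra.Build K B twist_scaleAl.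

Fact twist_scaleAr k (a b : B) : k *: (a * b) = a * (k *: b : B).
Proof. exact/esym/(linZ (twist_mulr_linear a)). Qed.

HB.instance Definition _ := GRing.Lalgebra_isAlgebra.Build K B twist_scaleAr.

Fact twist_free (c : I -> K) :
  \sum_i c i *: (qgen A i : B) = 0 -> forall i, c i = 0.
Proof. exact: qgen_free. Qed.

Lemma tmul_surj n (x : T) : Tdeg n.+1 x -> exists2 t, TTdeg 1 n t & tmul t = x.
Proof.
move=> hx; pose f (w : {fmonom I}) : TT :=
  << (FMonom (take 1 w), FMonom (drop 1 w)) >>.
exists (linext f x).
  apply: (lin_in (@linext_is_linear _ _ _ f) (@TTdeg_subspace _ _ _ _)) => w /hx.
  case: w => [[|i s]] //= [<-]; rewrite linextU /f /= take0 drop0.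
  exact: (TTdegU (FMonom [:: i]) (FMonom s)).
apply: (malg_eq_lin (f := fun x => tmul (linext f x)) (g := fun x => x)) => //.
  by apply: lin_comp; [exact: tmul_linear|exact: linext_is_linear].
move=> w; rewrite linextU /tmul linextU /=; congr << _ >>.
by apply/eqP; rewrite fmP fmM /= cat_take_drop.
Qed.

Fact twist_generates (S : {pred B}) : GRing.subalg_closed S ->
  (forall i, (qgen A i : B) \in S) -> forall a, a \in S.
Proof.
move=> [S1 Slin Smul] Sgen a.
have S0 : (0 : B) \in S by have := Slin (-1) _ _ S1 S1; rewrite scaleN1r addNr.
have Ssub : subspace [set a : B | a \in S].
  by split=> // c x y; apply: Slin.
have H n : forall x, Tdeg n x -> (canon A x : B) \in S.
  elim: n => [|n ih] x hx.
    suff -> : x = x@_mone *: 1.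
      rewrite (linZ (@canon_linear _ _ A)) canon1.
      exact: (subspaceZ _ Ssub S1).
    apply/malgP => w; rewrite mcoeffZ mcoeff1.
    have [->|w1] := eqVneq w mone; first by rewrite mulr1.
    by move/TdegP: hx => ->; rewrite ?fdeg_eq0 // mulr0.
  have [t ht <-] := tmul_surj hx.
  have [t' ht' <-] : (psi @` TTdeg 1 n) t by case: Zpsi => [[_ _ ->] _ _].
  have lf : linear (fun t => canon A (tmul (psi t))).
    apply: lin_comp; first exact: canon_linear.
    by apply: lin_comp; [exact: tmul_linear|exact: psi_linear].
  apply: (lin_in (f := fun t => canon A (tmul (psi t)))
                 (S := [set a : A | (a : B) \in S]) lf Ssub).
  move=> [u v] /ht'[/= hu hv]; rewrite /= -tensUU -/(cochain_mul _ _ _) -twist_mulE.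
  apply: Smul; last by apply: ih; rewrite -hv; apply: TdegU.
  case: u hu => [[|i [|//]]] //= _.
  by have := canon_gen A i; rewrite fmuE => ->.
have [x <-] := canon_surj a; have [N ->] := hcomp_sum x.
rewrite (lin_sum (@canon_linear _ _ A)).
apply: (subspace_sum (S := [set a : A | (a : B) \in S]) Ssub) => n _ /=.
by apply: (H n); apply: Tdeg_hcomp.
Qed.

(* A_psi: the vector space and unit of A with the product twist_mul. *)
Definition twist : qspace K I :=
  @QSpace K I (twist_alg Zpsi Apsi) (qgen A) twist_free twist_generates.

Definition twist_lift : T -> T :=
  linext (fun w : {fmonom I} =>
    foldr (fun i x => cochain_mul psi << fmu i >> x) 1 w).

Lemma twist_lift_linear : linear twist_lift.
Proof. exact: linext_is_linear. Qed.

Lemma canon_twist x : canon twist x = canon A (twist_lift x).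
Proof.
apply: (@malg_eq_lin _ _ A (canon twist) (fun x => canon A (twist_lift x))).
- exact: (@canon_linear _ _ twist).
- by apply: lin_comp; [exact: canon_linear|exact: twist_lift_linear].
case=> w; rewrite /twist_lift linextU (@canonU _ _ twist) /=.
elim: w => [|i w ih]; first by rewrite big_nil canon1.
by rewrite big_cons ih /= -twist_mulE canon_gen.
Qed.

Lemma Tdeg_twist_lift n x : Tdeg n x -> Tdeg n (twist_lift x).
Proof.
move=> hx; apply: (lin_in twist_lift_linear (Tdeg_subspace _)) => w /hx <-.
rewrite /twist_lift linextU; case: w => w; rewrite fdegE /=.
elim: w => [|i w ih] /=.
  by have := TdegU (K := K) (mone : {fmonom I}); rewrite fdeg1.
rewrite -[(size w).+1]add1n; apply: Tdeg_cochain_mul => //.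
by have := TdegU (K := K) (fmu i); rewrite fdegU.
Qed.

Lemma hcomp_twist_lift n x : hcomp n (twist_lift x) = twist_lift (hcomp n x).
Proof.
move: x; apply: malg_eq_lin.
- by apply: lin_comp; [exact: hcomp_linear|exact: twist_lift_linear].
- by apply: lin_comp; [exact: twist_lift_linear|exact: hcomp_linear].
move=> w; rewrite (hcomp_Tdeg _ (TdegU w)).
rewrite (hcomp_Tdeg _ (Tdeg_twist_lift (TdegU w))).
by case: ifP => _ //; rewrite (lin0 twist_lift_linear).
Qed.

Lemma twist_conic : conic A -> conic twist.
Proof.
move=> /conicP cA; apply/conicP => n x; rewrite /qideal /= !canon_twist.
by rewrite -hcomp_twist_lift; apply: cA.
Qed.

End Twisting.

Section Admissibility.
Context {K : fieldType} {I : finType} (A : qspace K I).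
Local Notation T := (tensor_alg K I).
Local Notation TT := (tensor_alg2 K I).

(* ker Pi^{(x) 2} = ker Pi (x) T + T (x) ker Pi. *)
Lemma ker2E : ker2 A =
  lspan [set t | exists x y, (qideal A x \/ qideal A y) /\ t = tens x y].
Proof.
set N := lspan _; have sN : subspace N by exact: lspan_subspace.
have Nl x y : qideal A x -> N (tens x y).
  by move=> hx; apply: sub_lspan; exists x, y; split; [left|].
have Nr x y : qideal A y -> N (tens x y).
  by move=> hy; apply: sub_lspan; exists x, y; split; [right|].
have tl := @tens_linearl K {fmonom I} {fmonom I}.
have tr := @tens_linearr K {fmonom I} {fmonom I}.
apply/seteqP; split; last first.
  apply: lspan_min; first exact: ker2_subspace.
  move=> _ [x [y [h ->]]]; rewrite /ker2 /mkset canon2_tens.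
  case: h => ->; first exact: (lin0 (tensor_linearl _)).
  exact: (lin0 (tensor_linearr _)).
pose s (a : A) : T := xget 0 [set x | canon A x = a].
have sK a : canon A (s a) = a.
  rewrite /s; case: xgetP => [x _ //|h]; have [x e] := canon_surj a.
  by case: (h x).
have cl := @canon_linear _ _ A.
have ker x y : canon A x = canon A y -> qideal A (x - y).
  by move=> e; rewrite /qideal /mkset (linB cl) e subrr.
pose G := linext (fun p : A * A => tens (s p.1) (s p.2)) : {malg K[(A * A)%type]} -> TT.
have lG : linear G by exact: linext_is_linear.
have GU a b : G << (a, b) >> = tens (s a) (s b) by exact: linextU.
pose L := linext (fun p : {fmonom I} * {fmonom I} =>
  << (canon A << p.1 >>, canon A << p.2 >>) >> : {malg K[(A * A)%type]}) : TT -> _.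
have lL : linear L by exact: linext_is_linear.
have GR t : lspan (@bilinear_rels K A A) t -> N (G t).
  apply: lspan_image => // _ [[c [u [u' [w ->]]]]|[c [u [w [w' ->]]]]];
    rewrite (linB lG) (linD lG) (linZ lG) !GU.
    rewrite -tl -(linB (tl _)); apply: Nl; apply: ker.
    by rewrite sK cl !sK.
  rewrite -tr -(linB (tr _)); apply: Nr; apply: ker.
  by rewrite sK cl !sK.
have canon2L z : canon2 A z = lpi (lspan_subspace (@bilinear_rels K A A)) (L z).
  move: z; apply: malg_eq_lin; first exact: canon2_linear.
    by apply: lin_comp; [exact: lpi_linear|].
  by move=> [u v]; rewrite /L /canon2 !linextU.
move=> z; rewrite /ker2 /mkset canon2L => /lpi0/GR NGLz.
rewrite -[z](subKr (G (L z))); apply: (subspaceB sN) => //.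
pose D z := G (L z) - z.
have lD : linear D.
  move=> c x y; rewrite /D lL lG scalerBr opprD addrACA.
  by [].
apply: (lin_in (f := D) lD sN) => -[u v] _.
rewrite /D /L linextU GU /= -tensUU.
set x := s _; set y := s _.
have -> : tens x y - tens << u >> << v >> =
    tens (x - << u >>) y + tens << u >> (y - << v >>).
  by rewrite (linB (tl y)) (linB (tr _)) addrA subrK.
apply: (subspaceD sN); first by apply: Nl; apply: ker; exact: sK.
by apply: Nr; apply: ker; exact: sK.
Qed.

Lemma admissible2_admissible psi :
  conic A -> linear psi -> admissible2 A psi -> admissible A psi.
Proof.
move=> /conicP cA lpsi h; rewrite /admissible ker2E.
set X := [set t | _]; have sX : subspace (lspan X) by exact: lspan_subspace.
have tl := @tens_linearl K {fmonom I} {fmonom I}.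
have tr := @tens_linearr K {fmonom I} {fmonom I}.
have e q : mulsp (mulsp (Tdeg 0) (hideal A q)) (Tdeg 0) = hideal A q.
  have T1 : Tdeg 0 (1 : T).
    by have := TdegU (K := K) (mone : {fmonom I}); rewrite fdeg1.
  have sq : subspace (hideal A q).
    split; first by split; [case: (qideal_subspace A)|case: (@Tdeg_subspace K I q)].
    move=> c x y [hx nx] [hy ny]; split.
      by case: (qideal_subspace A) => _; apply.
    by case: (@Tdeg_subspace K I q) => _; apply.
  apply/seteqP; split=> [|x hx].
    apply: lspan_min => // _ [x hx [y y0 <-]].
    suff : hideal A q x.
      move=> [xA xq]; split; first by case: (qideal_ideal A) => _ /(_ y _ xA)[].
      by rewrite -[q]addn0; apply: TdegM.
    apply: (lspan_min sq _ hx) => _ [z z0 [w [wA wq] <-]]; split.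
      by case: (qideal_ideal A) => _ /(_ z _ wA)[].
    by rewrite -[q]add0n; apply: TdegM.
  apply: sub_lspan; exists x; last by exists 1; rewrite ?mulr1.
  by apply: sub_lspan; exists 1 => //; exists x; rewrite ?mul1r.
pose Y := [set t : TT | exists q s, tensp (Tdeg s) (hideal A q) t \/
                            tensp (hideal A q) (Tdeg s) t].
have XY : lspan X = lspan Y.
  apply/seteqP; split; apply: lspan_min; try exact: lspan_subspace.
    move=> _ [x [y [hxy ->]]].
    have [N ->] := hcomp_sum x; have [M ->] := hcomp_sum y.
    rewrite (lin_sum (tl _)); apply: (subspace_sum (lspan_subspace _)) =>
      r _; rewrite (lin_sum (tr _)).
    apply: (subspace_sum (lspan_subspace _)).
    move=> s _; apply: sub_lspan; case: hxy => [hx|hy].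
      exists r, s; right; apply: sub_lspan; exists (hcomp r x).
        by split; [exact: cA|exact: Tdeg_hcomp].
      by exists (hcomp s y) => //; exact: Tdeg_hcomp.
    exists s, r; left; apply: sub_lspan; exists (hcomp r x).
      exact: Tdeg_hcomp.
    by exists (hcomp s y) => //; split; [exact: cA|exact: Tdeg_hcomp].
  move=> t [q [s [ht|ht]]]; apply: (lspan_min sX _ ht) => _ [x hx [y hy <-]];
    apply: sub_lspan; exists x, y; split=> //.
    by right; case: hy.
  by left; case: hx.
have [psiY Ypsi] : (forall t, Y t -> Y (psi t)) /\ (forall t, Y t -> exists2 u, Y u & psi u = t).
  split=> t [q [s ht]]; have := h 0 q 0 s; rewrite /= e => -[h1 h2].
    exists q, s; case: ht => ht; [left; rewrite -h1|right; rewrite -h2]; by exists t.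
  case: ht => ht.
    have [u hu <-] : (psi @` tensp (Tdeg s) (hideal A q)) t by rewrite h1.
    by exists u => //; exists q, s; left.
  have [u hu <-] : (psi @` tensp (hideal A q) (Tdeg s)) t by rewrite h2.
  by exists u => //; exists q, s; right.
rewrite XY; apply/seteqP; split.
  move=> _ [t ht <-]; move: t ht; apply: lspan_image => //.
    exact: lspan_subspace.
  by move=> t /psiY; apply: sub_lspan.
apply: lspan_min; last by move=> t /Ypsi[u Yu <-]; exists u => //; apply: sub_lspan.
have sY : subspace (lspan Y) by exact: lspan_subspace.
split; first by exists 0; [case: sY|exact: lin0 lpsi].
move=> c _ _ [x hx <-] [y hy <-]; exists (c *: x + y); last by rewrite lpsi.
by case: sY => _; apply.
Qed.

End Admissibility.

Lemma mcoeff_fmu_sum (K : fieldType) (I : finType) (c : I -> K) i :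
  (\sum_j c j *: << fmu j >> : tensor_alg K I)@_(fmu i) = c i.
Proof.
rewrite raddf_sum /=; under eq_bigr => j _ do rewrite mcoeffZ mcoeffU1.
rewrite (bigD1 i) //= eqxx mulr1 big1 ?addr0 // => j ji.
case: eqP => [/eqP|]; last by rewrite mulr0.
by rewrite fmP !fmU => /eqP[] ij; rewrite ij eqxx in ji.
Qed.

Section QuotientAlgebra.
Context {K : fieldType} {I : finType}.
Local Notation T := (tensor_alg K I).

(* Homogeneous two-sided ideals without elements of degree 0 and 1, i.e. the
   ideals of conic quantum spaces. *)
Definition conic_ideal (J : set T) := [/\ is_ideal J,
  forall n x, J x -> J (hcomp n x) &
  forall x, J x -> hcomp 0 x = 0 /\ hcomp 1 x = 0].

Lemma conic_ideal_subspace J : conic_ideal J -> subspace J.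
Proof. by case=> [[]]. Qed.

Context {J : set T} (hJ : conic_ideal J).

Definition quot_alg (_ : conic_ideal J) : Type := lquot (conic_ideal_subspace hJ).

Local Notation B := (quot_alg hJ).

HB.instance Definition _ := GRing.Lmodule.on B.

Let p (x : T) : B := lpi (conic_ideal_subspace hJ) x.
Let r (b : B) : T := lrepr b.

Let pK b : p (r b) = b. Proof. exact: lreprK. Qed.

Let p_linear : linear p. Proof. exact: lpi_linear. Qed.

Let p0 x : p x = 0 <-> J x. Proof. exact: lpi0. Qed.

Let pB x y : p x = p y <-> J (x - y). Proof. exact: lpi_eq. Qed.

Definition quot_mul (a b : B) : B := p (r a * r b).

Fact quot_mulE x y : quot_mul (p x) (p y) = p (x * y).
Proof.
have [[sJ J2] _ _] := hJ; apply/pB.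
have h z : J (r (p z) - z) by apply/pB; rewrite pK.
have -> : r (p x) * r (p y) - x * y =
    (r (p x) - x) * r (p y) + x * (r (p y) - y).
  by rewrite mulrBl mulrBr addrA subrK.
apply: (subspaceD sJ); first exact: (proj2 (J2 (r (p y)) _ (h x))).
exact: (proj1 (J2 x _ (h y))).
Qed.

Fact quot_mulA : associative quot_mul.
Proof. by move=> a b c; rewrite -(pK a) -(pK b) -(pK c) !quot_mulE mulrA. Qed.

Fact quot_mul1 : left_id (p 1) quot_mul.
Proof. by move=> a; rewrite -(pK a) quot_mulE mul1r. Qed.

Fact quot_mulr1 : right_id (p 1) quot_mul.
Proof. by move=> a; rewrite -(pK a) quot_mulE mulr1. Qed.

Fact quot_mulDl : left_distributive quot_mul +%R.
Proof.
move=> a b c; rewrite -(pK a) -(pK b) -(pK c) -(linD p_linear) !quot_mulE.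
by rewrite mulrDl (linD p_linear).
Qed.

Fact quot_mulDr : right_distributive quot_mul +%R.
Proof.
move=> a b c; rewrite -(pK a) -(pK b) -(pK c) -(linD p_linear) !quot_mulE.
by rewrite mulrDr (linD p_linear).
Qed.

Fact quot_1_neq0 : p 1 != 0.
Proof.
apply/eqP => /p0 J1; have [_ _ /(_ _ J1)[+ _]] := hJ.
have T1 : Tdeg 0 (1 : T).
  by have := TdegU (K := K) (mone : {fmonom I}); rewrite fdeg1.
by rewrite (hcomp_Tdeg _ T1) eqxx => /eqP; rewrite oner_eq0.
Qed.

HB.instance Definition _ := GRing.Zmodule_isNzRing.Build B
  quot_mulA quot_mul1 quot_mulr1 quot_mulDl quot_mulDr quot_1_neq0.

Lemma quot_mulrE x y : p x * p y = p (x * y). Proof. exact: quot_mulE. Qed.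

Fact quot_scaleAl k (a b : B) : k *: (a * b) = (k *: a : B) * b.
Proof.
rewrite -(pK a) -(pK b) quot_mulrE -!(linZ p_linear) quot_mulrE.
by rewrite scalerAl.
Qed.

HB.instance Definition _ := GRing.Lmodule_isLalgebra.Build K B quot_scaleAl.

Fact quot_scaleAr k (a b : B) : k *: (a * b) = a * (k *: b : B).
Proof.
rewrite -(pK a) -(pK b) quot_mulrE -!(linZ p_linear) quot_mulrE.
by rewrite malg_scalerAr.
Qed.

HB.instance Definition _ := GRing.Lalgebra_isAlgebra.Build K B quot_scaleAr.

Definition quot_gen (i : I) : B := p << fmu i >>.

Fact quot_free (c : I -> K) :
  \sum_i c i *: quot_gen i = 0 -> forall i, c i = 0.
Proof.
pose x : T := \sum_i c i *: << fmu i >>.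
have -> : \sum_i c i *: quot_gen i = p x.
  by rewrite (lin_sum p_linear); apply: eq_bigr => i _; rewrite (linZ p_linear).
move=> /p0 Jx i; have [_ _ /(_ _ Jx)[_]] := hJ.
rewrite (hcomp_Tdeg 1 (n := 1)) ?eqxx => [x0|]; last first.
  apply: (subspace_sum (@Tdeg_subspace K I 1)) => j _.
  apply: (subspaceZ _ (@Tdeg_subspace K I 1)).
  by have := TdegU (K := K) (fmu j); rewrite fdegU.
by rewrite -[LHS](mcoeff_fmu_sum c) -/x x0 mcoeff0.
Qed.

Fact quot_prod (w : seq I) : \prod_(i <- w) quot_gen i = p << FMonom w >>.
Proof.
elim: w => [|i w ih]; first by rewrite big_nil; congr p; rewrite -fmoneE.
by rewrite big_cons ih quot_mulrE malg_mulUU; congr (p << _ >>); apply/eqP;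
  rewrite fmP fmM fmU.
Qed.

Fact quot_generates (S : {pred B}) : GRing.subalg_closed S ->
  (forall i, quot_gen i \in S) -> forall a, a \in S.
Proof.
move=> [S1 Slin Smul] Sgen a; rewrite -(pK a).
have Ssub : subspace [set b : B | b \in S].
  split; last by move=> c x y; apply: Slin.
  by have := Slin (-1) _ _ S1 S1; rewrite scaleN1r addNr.
apply: (lin_in p_linear Ssub) => -[w] _ /=; rewrite -quot_prod.
by elim: w => [|i w ih]; rewrite ?big_nil // big_cons; apply: Smul.
Qed.

Definition quot_qspace : qspace K I :=
  @QSpace K I B quot_gen quot_free quot_generates.

Lemma qideal_quot : qideal quot_qspace = J.
Proof.
have e x : canon quot_qspace x = p x.
  move: x; apply: (@malg_eq_lin _ _ B (canon quot_qspace) p).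
  - exact: (@canon_linear _ _ quot_qspace).
  - exact: p_linear.
  by case=> w; rewrite canonU -quot_prod.
by apply/seteqP; split=> x; rewrite /qideal /mkset e p0.
Qed.

Lemma quot_conic : conic quot_qspace.
Proof. by apply/conicP; rewrite qideal_quot; case: hJ. Qed.

End QuotientAlgebra.

Record conic_qspace (K : fieldType) (I : finType) := ConicQSpace {
  conic_val :> qspace K I;
  conic_prop : conic conic_val }.

Definition conic_quot (K : fieldType) (I : finType) (J : set (tensor_alg K I))
  (hJ : conic_ideal J) : conic_qspace K I := ConicQSpace (quot_conic hJ).

Lemma Z2_linear (K : fieldType) (I : finType)
  (psi : tensor_alg2 K I -> tensor_alg2 K I) : Z2 psi -> linear psi.
Proof. by case=> [[]]. Qed.

Definition conic_twist (K : fieldType) (I : finType) (A : conic_qspace K I)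
  (psi : tensor_alg2 K I -> tensor_alg2 K I) (Zpsi : Z2 psi)
  (Apsi : admissible2 A psi) : conic_qspace K I :=
  ConicQSpace (twist_conic Zpsi
    (admissible2_admissible (conic_prop A) (Z2_linear Zpsi) Apsi)
    (conic_prop A)).

Section HomogeneousIdeals.
Context {K : fieldType} {I : finType}.
Local Notation T := (tensor_alg K I).

Lemma ideal_gen_conic (X : set T) :
  (forall x, X x -> exists2 n, (2 <= n)%N & Tdeg n x) ->
  conic_ideal (ideal_gen X).
Proof.
move=> hX; pose J := ideal_gen X; have iJ : is_ideal J by exact: ideal_gen_ideal.
have [sJ J2] := iJ.
pose M := [set x : T | forall n, J (hcomp n x) /\ ((n < 2)%N -> hcomp n x = 0)].
have hl n := @hcomp_linear K I n.
have sM : subspace M.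
  split=> [n|c x y hx hy n]; first by rewrite (lin0 (hl n)); split=> //; case: sJ.
  have [hx1 hx2] := hx n; have [hy1 hy2] := hy n; rewrite hl; split.
    by case: sJ => _; apply.
  by move=> n2; rewrite hx2 ?hy2 // scaler0 addr0.
have M2 m a x : Tdeg m a -> M x -> M (a * x) /\ M (x * a).
  move=> ha hx; have [N ex] := hcomp_sum x.
  have -> : a * x = \sum_(k < N) a * hcomp k x by rewrite {1}ex mulr_sumr.
  have -> : x * a = \sum_(k < N) hcomp k x * a by rewrite {1}ex mulr_suml.
  split; apply: (subspace_sum sM) => k _ n; have [h1 h2] := hx k.
    rewrite (hcomp_Tdeg n (TdegM ha (Tdeg_hcomp k x))).
    case: eqP => [->|_]; last by split=> //; case: sJ.
    split; first exact: (proj1 (J2 a _ h1)).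
    by move=> lt; rewrite h2 ?mulr0 // (leq_ltn_trans _ lt) // leq_addl.
  rewrite (hcomp_Tdeg n (TdegM (Tdeg_hcomp k x) ha)).
  case: eqP => [->|_]; last by split=> //; case: sJ.
  split; first exact: (proj2 (J2 a _ h1)).
  by move=> lt; rewrite h2 ?mul0r // (leq_ltn_trans _ lt) // leq_addr.
have iM : is_ideal M.
  split; first exact: sM.
  move=> a x hx; have [N ->] := hcomp_sum a.
  rewrite mulr_suml mulr_sumr; split; apply: (subspace_sum sM) => k _.
    exact: (proj1 (M2 k _ x (Tdeg_hcomp k a) hx)).
  exact: (proj2 (M2 k _ x (Tdeg_hcomp k a) hx)).
have JM : J `<=` M.
  move=> x; apply; split; first exact: iM.
  move=> y Xy n; have [m m2 hm] := hX y Xy.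
  rewrite (hcomp_Tdeg n hm); case: eqP => [->|_]; last by split=> //; case: sJ.
  by split; [exact: sub_ideal_gen|rewrite ltnNge m2].
split; [exact: iJ|by move=> n x /JM/(_ n)[]|move=> x /JM hx].
by split; [case: (hx 0%N) => _ h; exact: h|case: (hx 1%N) => _ h; exact: h].
Qed.

Lemma ideal_gen_sumsp (X : nat -> set T) :
  ideal_gen (sumsp X) = ideal_gen (\bigcup_n X n).
Proof.
apply/seteqP; split=> x hx M [iM XM]; apply: hx; split=> //.
  by apply: lspan_min => //; case: iM.
by move=> y hy; apply: XM; apply: sub_lspan.
Qed.

Lemma ideal_gen_lspan (X : set T) : ideal_gen (lspan X) = ideal_gen X.
Proof.
apply/seteqP; split=> x hx M [iM XM]; apply: hx; split=> //.
  by apply: lspan_min => //; case: iM.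
by move=> y hy; apply: XM; apply: sub_lspan.
Qed.

End HomogeneousIdeals.

Section Operations.
Context {K : fieldType} {I J : finType}.
Implicit Types (A : conic_qspace K I) (B : conic_qspace K J).
Local Notation TI := (tensor_alg K I).
Local Notation TJ := (tensor_alg K J).
Local Notation TIJ := (tensor_alg K (I * J)%type).

Lemma shuffle_linearl (y : TJ) : linear (fun x : TI => shuffle x y).
Proof. exact: linext2Pl. Qed.

Lemma shuffle_linearr (x : TI) : linear (@shuffle K I J x).
Proof. exact: linext2Pr. Qed.

Lemma shuffleUU u v : shuffle (<< u >> : TI) (<< v >> : TJ) = << fzip u v >>.
Proof. exact: linext2UU. Qed.

Lemma Tdeg_shuffle n (x : TI) (y : TJ) :
  Tdeg n x -> Tdeg n y -> Tdeg n (shuffle x y).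
Proof.
move=> hx hy.
apply: (lin_in (shuffle_linearl y) (Tdeg_subspace _)) => u /hx hu.
apply: (lin_in (shuffle_linearr _) (Tdeg_subspace _)) => v /hy hv.
rewrite shuffleUU.
have := TdegU (K := K) (fzip u v); rewrite [fdeg _]fdegE /= size_zip.
by rewrite -!fdegE hu hv minnn.
Qed.

Lemma shuffle_mull (z : {fmonom (I * J)%type}) (x : TI) (y : TJ) :
  << z >> * shuffle x y =
  shuffle (<< FMonom (unzip1 z) >> * x) (<< FMonom (unzip2 z) >> * y).
Proof.
move: x y; apply: malg_bilin_ext.
- by move=> y; apply: (lin_comp (malg_mulr_linear _) (shuffle_linearl y)).
- by move=> x; apply: (lin_comp (malg_mulr_linear _) (shuffle_linearr x)).
- by move=> y; apply: (lin_comp (shuffle_linearl _) (malg_mulr_linear _)).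
- by move=> x; apply: (lin_comp (shuffle_linearr _) (malg_mulr_linear _)).
move=> u v; rewrite !malg_mulUU !shuffleUU malg_mulUU; congr << _ >>.
apply/eqP; rewrite fmP fmM /= !fmM /= zip_cat ?size_map //.
by rewrite zip_unzip.
Qed.

Lemma shuffle_mulr n (z : {fmonom (I * J)%type}) (x : TI) (y : TJ) :
  Tdeg n x -> Tdeg n y ->
  shuffle x y * << z >> =
  shuffle (x * << FMonom (unzip1 z) >>) (y * << FMonom (unzip2 z) >>).
Proof.
move=> hx hy; set a : TI := << _ >>; set b : TJ := << _ >>.
have s0 : subspace [set t : TIJ | t = 0].
  by split=> // c t t' /= -> ->; rewrite scaler0 addr0.
have lB (U W : lmodType K) (f g : U -> W) :
    linear f -> linear g -> linear (fun x => f x - g x).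
  by move=> lf lg c t t'; rewrite lf lg scalerBr opprD addrACA.
apply/eqP; rewrite -subr_eq0; apply/eqP.
apply: (lin_in (f := fun x => shuffle x y * << z >> - shuffle (x * a) (y * b)) _ s0).
  apply: lB; first exact: (lin_comp (malg_mull_linear _) (shuffle_linearl _)).
  exact: (lin_comp (shuffle_linearl _) (malg_mull_linear _)).
move=> u /hx hu.
apply: (lin_in (f := fun y => shuffle << u >> y * << z >> -
    shuffle (<< u >> * a) (y * b)) _ s0).
  apply: lB; first exact: (lin_comp (malg_mull_linear _) (shuffle_linearr _)).
  exact: (lin_comp (shuffle_linearr _) (malg_mull_linear _)).
move=> v /hy hv; rewrite /mkset /a /b !malg_mulUU !shuffleUU malg_mulUU.
apply/eqP; rewrite subr_eq0; apply/eqP; congr << _ >>.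
apply/eqP; rewrite fmP fmM /= !fmM /= zip_cat ?zip_unzip //.
by rewrite -!fdegE hu hv.
Qed.

Lemma shuffle_sp_deg n (X : set TI) (Y : set TJ) t :
  X `<=` Tdeg n -> Y `<=` Tdeg n ->
  ((n < 2)%N -> X `<=` [set 0] \/ Y `<=` [set 0]) ->
  shuffle_sp X Y t -> exists2 m, (2 <= m)%N & Tdeg m t.
Proof.
move=> hX hY h ht; have [n2|n2] := ltnP n 2.
  exists 2%N => //; suff -> : t = 0 by case: (@Tdeg_subspace K (I * J)%type 2).
  move: t ht; apply: (lspan_min (S := [set t | t = 0])).
    by split=> // c t t' /= -> ->; rewrite scaler0 addr0.
  move=> _ [x Xx [y Yy <-]]; rewrite /mkset; case: (h n2).
    by move/(_ _ Xx) => ->; exact: (lin0 (shuffle_linearl _)).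
  by move/(_ _ Yy) => ->; exact: (lin0 (shuffle_linearr _)).
exists n => //; move: t ht; apply: lspan_min; first exact: Tdeg_subspace.
by move=> _ [x Xx [y Yy <-]]; apply: Tdeg_shuffle; [exact: hX|exact: hY].
Qed.

Lemma hideal_low (L : finType) (A : qspace K L) n :
  (n < 2)%N -> hideal A n `<=` [set 0].
Proof. by case: n => [|[|//]] _ x; [exact: hideal0|exact: hideal1]. Qed.

Lemma annihilator_low (L : finType) n (X : set (tensor_alg K L)) :
  (n < 2)%N -> annihilator n X `<=` [set 0].
Proof. by rewrite /annihilator ltnNge => /negPf ->. Qed.

Lemma annihilator_deg (L : finType) n (X : set (tensor_alg K L)) :
  annihilator n X `<=` Tdeg n.
Proof.
rewrite /annihilator; case: ifP => _ f; first by case.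
by move=> ->; case: (@Tdeg_subspace K L n).
Qed.

Lemma hideal_deg (L : finType) (A : qspace K L) n : hideal A n `<=` Tdeg n.
Proof. by move=> x []. Qed.

Lemma gen_conic (X : nat -> set TI) (Y : nat -> set TJ) :
  (forall n, X n `<=` Tdeg n) -> (forall n, Y n `<=` Tdeg n) ->
  (forall n, (n < 2)%N -> X n `<=` [set 0] \/ Y n `<=` [set 0]) ->
  conic_ideal (ideal_gen (sumsp (fun n => shuffle_sp (X n) (Y n)))).
Proof.
move=> hX hY h; rewrite ideal_gen_sumsp; apply: ideal_gen_conic => t [n _].
exact: (shuffle_sp_deg (hX n) (hY n) (h n)).
Qed.

Definition odot_ideal A B : set TIJ :=
  sumsp (fun n => shuffle_sp (hideal A n) (hideal B n)).

Lemma odot_ideal_gen A B : odot_ideal A B = ideal_gen (odot_ideal A B).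
Proof.
apply/seteqP; split; first exact: sub_ideal_gen.
have sS : subspace (odot_ideal A B) by exact: lspan_subspace.
have [sA A2] := qideal_ideal A; have [sB B2] := qideal_ideal B.
suff S2 a t : odot_ideal A B t -> odot_ideal A B (a * t) /\ odot_ideal A B (t * a).
  by move=> t; apply; split.
have key (z : {fmonom (I * J)%type}) u :
    odot_ideal A B u -> odot_ideal A B (<< z >> * u) /\ odot_ideal A B (u * << z >>).
  move=> hu; split.
    apply: (lspan_image (malg_mulr_linear << z >>) sS _ hu) => s [n _ hs].
    apply: (lspan_image (malg_mulr_linear << z >>) sS _ hs).
    move=> _ [x [hx nx] [y [hy ny] <-]]; rewrite shuffle_mull.
    apply: sub_lspan; exists (fdeg z + n)%N => //; apply: sub_lspan.
    exists (<< FMonom (unzip1 z) >> * x).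
      split; first exact: (proj1 (A2 _ _ hx)).
      apply: TdegM => //; have := TdegU (K := K) (FMonom (unzip1 z)).
      by rewrite !fdegE /= size_map.
    exists (<< FMonom (unzip2 z) >> * y) => //.
    split; first exact: (proj1 (B2 _ _ hy)).
    apply: TdegM => //; have := TdegU (K := K) (FMonom (unzip2 z)).
    by rewrite !fdegE /= size_map.
  apply: (lspan_image (malg_mull_linear << z >>) sS _ hu) => s [n _ hs].
  apply: (lspan_image (malg_mull_linear << z >>) sS _ hs).
  move=> _ [x [hx nx] [y [hy ny] <-]]; rewrite (shuffle_mulr z nx ny).
  apply: sub_lspan; exists (n + fdeg z)%N => //; apply: sub_lspan.
  exists (x * << FMonom (unzip1 z) >>).
    split; first exact: (proj2 (A2 _ _ hx)).
    apply: TdegM => //; have := TdegU (K := K) (FMonom (unzip1 z)).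
    by rewrite !fdegE /= size_map.
  exists (y * << FMonom (unzip2 z) >>) => //.
  split; first exact: (proj2 (B2 _ _ hy)).
  apply: TdegM => //; have := TdegU (K := K) (FMonom (unzip2 z)).
  by rewrite !fdegE /= size_map.
move=> ht; split.
  by apply: (lin_in (malg_mull_linear t) sS) => z _; exact: (proj1 (key z t ht)).
by apply: (lin_in (malg_mulr_linear t) sS) => z _; exact: (proj2 (key z t ht)).
Qed.

Lemma odot_ideal_conic A B : conic_ideal (odot_ideal A B).
Proof.
rewrite odot_ideal_gen; apply: gen_conic => n; try exact: hideal_deg.
by left; apply: hideal_low.
Qed.

Definition odot A B : conic_qspace K (I * J)%type :=
  conic_quot (odot_ideal_conic A B).

Fact triangler_conic A B : conic_ideal (ideal_gen (sumsp (fun n =>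
  shuffle_sp (annihilator n (hideal A n)) (hideal B n)))).
Proof.
apply: gen_conic => n; [exact: annihilator_deg|exact: hideal_deg|].
by left; apply: annihilator_low.
Qed.

Definition triangler A B : conic_qspace K (I * J)%type :=
  conic_quot (triangler_conic A B).

Fact trianglel_conic A B : conic_ideal (ideal_gen (sumsp (fun n =>
  shuffle_sp (hideal A n) (annihilator n (hideal B n))))).
Proof.
apply: gen_conic => n; [exact: hideal_deg|exact: annihilator_deg|].
by left; apply: hideal_low.
Qed.

Definition trianglel A B : conic_qspace K (I * J)%type :=
  conic_quot (trianglel_conic A B).

Fact diamond_conic A B : conic_ideal (ideal_gen (sumsp (fun n =>
  shuffle_sp (annihilator n (hideal A n)) (annihilator n (hideal B n))))).
Proof.
apply: gen_conic => n; [exact: annihilator_deg|exact: annihilator_deg|].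
by left; apply: annihilator_low.
Qed.

Definition diamond A B : conic_qspace K (I * J)%type :=
  conic_quot (diamond_conic A B).

Fact bullet_conic (m : nat) A B :
  conic_ideal (ideal_gen (shuffle_sp (hideal A m) (hideal B m))).
Proof.
apply: ideal_gen_conic => t; apply: (@shuffle_sp_deg m); try exact: hideal_deg.
by left; apply: hideal_low.
Qed.

(* Only meaningful for m-th quantum spaces A and B. *)
Definition bullet (m : nat) A B : conic_qspace K (I * J)%type :=
  conic_quot (bullet_conic m A B).

End Operations.

(* The assertion C = D_psi, including that psi is a counital 2-cocycle
   admissible for D. *)
Definition eq_twist (K : fieldType) (I : finType) (C D : qspace K I)
    (psi : tensor_alg2 K I -> tensor_alg2 K I) :=
  exists (Zpsi : Z2 psi) (Dpsi : admissible D psi),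
    same_qspace C (twist Zpsi Dpsi).

(* Main.v *)
Require Import Defs.
From HB Require Import structures.
From mathcomp Require Import all_boot all_algebra finmap.
From mathcomp Require Import boolp classical_sets reals.
From mathcomp Require Import complex monalg.

(** Write T for the tensor algebra of V = A_1 and x * y for the product twisted
    by a counital 2-cocycle psi. The map theta from T to (T, * ) that is
    multiplicative and the identity on V is a graded linear bijection
    ([twist_liftM], [twist_lift_onto], [twist_lift_inj]), and the ideal of A_psi
    is the preimage under theta of the ideal of A. Each formula thus compares the
    preimage of an ideal with the ideal generated by preimages of subspaces.

    The two agree when the generating subspaces X of V^n are stable: psi maps
    V^s (x) (V^p X V^r) and (V^p X V^r) (x) V^s onto themselves. Then V^p X V^r
    is also the span of the twisted products of V^p, X and V^r, so theta maps
    the ideal generated by theta^-1(X) onto the one generated by X; stability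
    also gives the admissibility of psi ([eq_twist_generated]).

    For a 2nd admissible psi the homogeneous parts I_n are stable by definition.
    Stability passes to annihilators, for psi^! ([stable_bang]), because
    <psi^! f, psi t> = <f, t> and the annihilator of V^p X V^r is the subspace
    V*^p X^perp V*^r; and it passes to X (x) Y, for j(psi, phi)
    ([stable_shuffle]), because V^p X V^r and W^p Y W^r interleave to the
    corresponding subspace for X (x) Y. The maps theta are compatible with both
    constructions: <theta^! f, theta x> = <f, x> ([pairing_twist_lift]), so that
    theta^! maps the annihilator of theta^-1(X) onto that of X, and theta for
    j(psi, phi) is the tensor product of those for psi and phi
    ([twist_lift_shuffle]). The same two identities, in bidegree (r, s), make
    psi^! and j(psi, phi) counital 2-cocycles ([Z2_bang], [Z2_jmap]) and give
    j(psi, phi)^! = j(psi^!, phi^!) ([bang_jmap]). All five formulas are then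
    instances of [eq_twist_shuffle]. *)

Set Implicit Arguments.
Unset Strict Implicit.
Unset Printing Implicit Defensive.

Import GRing.Theory.

Local Open Scope classical_set_scope.
Local Open Scope ring_scope.

(** * Linear maps on free modules *)

Section LinearMaps.
Context {K : fieldType}.

(** Linearity with the argument in place, usable as a rewrite rule. *)
Lemma tensPl (G H : choiceType) c (x x' : {malg K[G]}) (y : {malg K[H]}) :
  tens (c *: x + x') y = c *: tens x y + tens x' y.
Proof. exact: tens_linearl. Qed.

Lemma tensPr (G H : choiceType) c (x : {malg K[G]}) (y y' : {malg K[H]}) :
  tens x (c *: y + y') = c *: tens x y + tens x y'.
Proof. exact: tens_linearr. Qed.

Lemma shufflePl (I J : finType) c (x x' : tensor_alg K I) (y : tensor_alg K J) :
  shuffle (c *: x + x') y = c *: shuffle x y + shuffle x' y.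
Proof. exact: shuffle_linearl. Qed.

Lemma shufflePr (I J : finType) c (x : tensor_alg K I) (y y' : tensor_alg K J) :
  shuffle x (c *: y + y') = c *: shuffle x y + shuffle x y'.
Proof. exact: shuffle_linearr. Qed.

Lemma shuffle2Pl (I J : finType) c (x x' : tensor_alg2 K I)
    (y : tensor_alg2 K J) :
  shuffle2 (c *: x + x') y = c *: shuffle2 x y + shuffle2 x' y.
Proof. exact: linext2Pl. Qed.

Lemma shuffle2Pr (I J : finType) c (x : tensor_alg2 K I)
    (y y' : tensor_alg2 K J) :
  shuffle2 x (c *: y + y') = c *: shuffle2 x y + shuffle2 x y'.
Proof. exact: linext2Pr. Qed.

Lemma tmulP (I : finType) c (s t : tensor_alg2 K I) :
  tmul (c *: s + t) = c *: tmul s + tmul t.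
Proof. exact: tmul_linear. Qed.

Lemma malg_mulPl (I : finType) c (x x' y : tensor_alg K I) :
  (c *: x + x') * y = c *: (x * y) + x' * y.
Proof. exact: malg_mull_linear. Qed.

Lemma malg_mulPr (I : finType) c (x y y' : tensor_alg K I) :
  x * (c *: y + y') = c *: (x * y) + x * y'.
Proof. exact: malg_mulr_linear. Qed.

Lemma pairingPl (G : choiceType) c (f f' x : {malg K[G]}) :
  pairing (c *: f + f') x = c * pairing f x + pairing f' x.
Proof. exact: (linext2Pl (U := K^o)). Qed.

Lemma pairingPr (G : choiceType) c (f x x' : {malg K[G]}) :
  pairing f (c *: x + x') = c * pairing f x + pairing f x'.
Proof. exact: (linext2Pr (U := K^o)). Qed.

Lemma pairing_linearl (G : choiceType) (x : {malg K[G]}) :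
  linear ((fun f => pairing f x) : {malg K[G]} -> K^o).
Proof. by move=> c f f'; rewrite pairingPl. Qed.

Lemma pairing_linearr (G : choiceType) (f : {malg K[G]}) :
  linear (pairing f : {malg K[G]} -> K^o).
Proof. by move=> c x x'; rewrite pairingPr. Qed.

Lemma lin_eq_in (G : choiceType) (U : lmodType K) (f g : {malg K[G]} -> U) x :
  linear f -> linear g -> (forall u, u \in msupp x -> f << u >> = g << u >>) ->
  f x = g x.
Proof.
move=> lf lg h; rewrite (malg_sum x) (lin_sum lf) (lin_sum lg).
by apply: eq_big_seq => u ux; rewrite (linZ lf) (linZ lg) h.
Qed.

(** The case U = K^o, typed over K: with U left to unification, [pairing] would
    be elaborated over K^o as its field of scalars. *)
Lemma scalar_eq_in (G : choiceType) (f g : {malg K[G]} -> K) x :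
  scalar f -> scalar g -> (forall u, u \in msupp x -> f << u >> = g << u >>) ->
  f x = g x.
Proof. exact: (@lin_eq_in G K^o). Qed.

Lemma scalar_bilin_ext (G H : choiceType)
    (f g : {malg K[G]} -> {malg K[H]} -> K) :
  (forall y, scalar (f^~ y)) -> (forall x, scalar (f x)) ->
  (forall y, scalar (g^~ y)) -> (forall x, scalar (g x)) ->
  (forall u v, f << u >> << v >> = g << u >> << v >>) ->
  forall x y, f x y = g x y.
Proof. exact: (@malg_bilin_ext K G H K^o). Qed.

End LinearMaps.

Definition linE := (@tensPl, @tensPr, @shufflePl, @shufflePr, @shuffle2Pl,
  @shuffle2Pr, @tmulP, @malg_mulPl, @malg_mulPr).

(** * The natural pairing *)

Section Pairing.
Context {K : fieldType}.

Lemma mcoeff_linear (G : choiceType) (g : G) :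
  linear ((fun x => x@_g) : {malg K[G]} -> K^o).
Proof. by move=> c x y; rewrite mcoeffD mcoeffZ. Qed.

Lemma pairingUU (G : choiceType) (g h : G) :
  pairing << g >> << h >> = (g == h)%:R :> K.
Proof. exact: (@linext2UU K G G K^o (fun g h => (g == h)%:R)). Qed.

Lemma mcoeff_basis (G : choiceType) (g h : G) :
  (<< g >> : {malg K[G]})@_h = (g == h)%:R.
Proof. by rewrite mcoeffU. Qed.

Lemma pairingUr (G : choiceType) (f : {malg K[G]}) g : pairing f << g >> = f@_g.
Proof.
apply: (@malg_eq_lin _ _ K^o (fun f => pairing f << g >>) (fun f => f@_g));
  [exact: pairing_linearl|exact: mcoeff_linear|move=> h].
exact: (etrans (pairingUU h g) (esym (mcoeff_basis h g))).
Qed.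

Lemma pairingUl (G : choiceType) g (x : {malg K[G]}) : pairing << g >> x = x@_g.
Proof.
apply: (@malg_eq_lin _ _ K^o (pairing << g >>) (fun x => x@_g));
  [exact: pairing_linearr|exact: mcoeff_linear|move=> h].
by apply: (etrans (pairingUU g h)); rewrite eq_sym; apply/esym/mcoeff_basis.
Qed.

Lemma pairing0 (G : choiceType) (f : {malg K[G]}) : pairing f 0 = 0.
Proof. exact: (lin0 (pairing_linearr f)). Qed.

Lemma pairing_inj (G : choiceType) (f g : {malg K[G]}) :
  (forall x, pairing f x = pairing g x) -> f = g.
Proof. by move=> h; apply/malgP => k; rewrite -!pairingUr h. Qed.

Lemma pairing_injr (G : choiceType) (x y : {malg K[G]}) :
  (forall f, pairing f x = pairing f y) -> x = y.
Proof. by move=> h; apply/malgP => k; rewrite -!pairingUl h. Qed.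

Lemma pairing_tens (G H : choiceType) (f x : {malg K[G]}) (g y : {malg K[H]}) :
  pairing (tens f g) (tens x y) = pairing f x * pairing g y.
Proof.
move: f g; apply: scalar_bilin_ext.
- by move=> g c f f'; rewrite linE pairingPl.
- by move=> f c g g'; rewrite linE pairingPl.
- by move=> g c f f'; rewrite pairingPl mulrDl mulrA.
- by move=> f c g g'; rewrite pairingPl mulrDr mulrCA.
move=> u v; move: x y; apply: scalar_bilin_ext.
- by move=> g c f f'; rewrite linE pairingPr.
- by move=> f c g g'; rewrite linE pairingPr.
- by move=> g c f f'; rewrite pairingPr mulrDl mulrA.
- by move=> f c g g'; rewrite pairingPr mulrDr mulrCA.
move=> x y; rewrite !tensUU !pairingUr !mcoeff_basis xpair_eqE.
by case: (u == x); case: (v == y); rewrite ?mulr0 ?mulr1.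
Qed.

Context {I : finType}.
Local Notation T := (tensor_alg K I).
Local Notation TT := (tensor_alg2 K I).

Lemma mmul_deg_inj (u v u' v' : {fmonom I}) : fdeg u = fdeg u' ->
  (mmul u v == mmul u' v') = ((u, v) == (u', v')).
Proof. by rewrite fmP !fmM !fdegE => e; rewrite eqseq_cat // xpair_eqE !fmP. Qed.

(** Words of fixed lengths r and s are recovered from their concatenation;
    across bidegrees, distinct pairs of words can have the same
    concatenation. *)
Lemma pairing_tmul r s (f t : TT) : TTdeg r s f -> TTdeg r s t ->
  pairing (tmul f) (tmul t) = pairing f t.
Proof.
move=> hf ht.
apply: (scalar_eq_in (f := fun f => pairing (tmul f) (tmul t))
  (g := fun f => pairing f t)) => [c x y|c x y|[u v] /hf[/= ru sv]];
  rewrite ?tmulP ?pairingPl //.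
apply: (scalar_eq_in (f := fun t => pairing (tmul << (u, v) >>) (tmul t))
  (g := fun t => pairing << (u, v) >> t)) => [c x y|c x y|];
  rewrite ?tmulP ?pairingPr //.
move=> [u' v'] /ht[/= ru' sv']; rewrite /tmul !linextU /=.
rewrite !pairingUr !mcoeff_basis.
by rewrite mmul_deg_inj // ru ru'.
Qed.

Lemma pairing_mul r s (f g x y : T) : Tdeg r f -> Tdeg s g -> Tdeg r x ->
  Tdeg s y -> pairing (f * g) (x * y) = pairing f x * pairing g y.
Proof.
move=> hf hg hx hy; rewrite -!tmul_tens (@pairing_tmul r s) ?pairing_tens //;
exact: TTdeg_tens.
Qed.

Lemma TdegU_of n (w : {fmonom I}) : fdeg w = n -> Tdeg n (<< w >> : T).
Proof. by move=> <-; apply: TdegU. Qed.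

Lemma TTdegP r s (t : TT) : TTdeg r s t <->
  forall p, (fdeg p.1 != r) || (fdeg p.2 != s) -> t@_p = 0.
Proof.
split=> h p.
  rewrite -negb_and => pn; apply/mcoeff_outdom; apply/negP => /h[p1 p2].
  by rewrite p1 p2 !eqxx in pn.
move=> pt; suff : (fdeg p.1 == r) && (fdeg p.2 == s) by case/andP=> /eqP ? /eqP.
by move: pt; rewrite -mcoeff_neq0; apply: contraNT; rewrite negb_and => /h ->.
Qed.

Definition words n : seq {fmonom I} :=
  [seq FMonom (tval t) | t <- enum {: n.-tuple I}].

Lemma mem_words n w : (w \in words n) = (fdeg w == n).
Proof.
apply/mapP/idP => [[t _ ->]|h]; first by rewrite fdegE /= size_tuple.
exists (tcast (eqP h) (in_tuple w)); first by rewrite mem_enum.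
by rewrite val_tcast /=; apply/eqP; rewrite fmP.
Qed.

Lemma words_uniq n : uniq (words n).
Proof.
rewrite map_inj_uniq ?enum_uniq // => s t /eqP; rewrite fmP /= => /eqP.
exact: val_inj.
Qed.

Lemma sum_words_delta n (F : {fmonom I} -> K) w : fdeg w = n ->
  \sum_(u <- words n) (u == w)%:R * F u = F w.
Proof.
move=> h; rewrite (bigD1_seq w) ?words_uniq ?mem_words ?h //= eqxx mul1r.
by rewrite big1 ?addr0 // => u /negPf ->; rewrite mul0r.
Qed.

End Pairing.

(** * The transpose and its inverse *)

Section Transpose.
Context {K : fieldType} {I : finType}.
Local Notation T := (tensor_alg K I).
Local Notation TT := (tensor_alg2 K I).
Implicit Types (psi chi : TT -> TT).

Definition graded psi := forall r s t, TTdeg r s t -> TTdeg r s (psi t).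

(** The inverse of a cochain is again linear and bigraded; carrying it along
    makes these properties available together. *)
Record C2_inverse psi psi' : Prop := C2Inverse {
  C2_lin : linear psi; C2_lin' : linear psi';
  C2_can : cancel psi psi'; C2_can' : cancel psi' psi;
  C2_graded : graded psi; C2_graded' : graded psi' }.

Lemma C2_inverse_sym psi psi' : C2_inverse psi psi' -> C2_inverse psi' psi.
Proof. by case. Qed.

Lemma C2P psi : C2 psi <-> exists psi', C2_inverse psi psi'.
Proof.
split=> [[lpsi [psi' K1 K2] im]|[psi' [l l' K1 K2 g g']]].
  exists psi'; split=> //.
  - by move=> c x y; apply: (can_inj K1); rewrite K2 lpsi !K2.
  - by move=> r s t ht; rewrite -im; exists t.
  - by move=> r s t; rewrite -{1}im => -[u hu <-]; rewrite K1.
split=> //; first by exists psi'.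
move=> r s; apply/seteqP; split=> [_ [t /g h <-] //|t /g' h].
by exists (psi' t).
Qed.

(** Its matrix is the transpose of that of [psi]. As [psi] preserves
    bidegrees, a column of the transpose is supported in one bidegree, so the
    sum over words of the right lengths is finite and complete. *)
Definition adjoint psi : TT -> TT :=
  linext (fun p : {fmonom I} * {fmonom I} =>
    \sum_(u <- words (fdeg p.1)) \sum_(v <- words (fdeg p.2))
      (psi << (u, v) >>)@_p *: << (u, v) >>).

Lemma adjoint_linear psi : linear (adjoint psi).
Proof. exact: linext_is_linear. Qed.

Lemma adjointUE psi p q : graded psi ->
  (adjoint psi << p >>)@_q = (psi << q >>)@_p.
Proof.
move=> g; case: p q => [p1 p2] [q1 q2].
rewrite /adjoint linextU /= raddf_sum /=.
pose c u v := (psi << (u, v) >>)@_(p1, p2).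
transitivity (\sum_(u <- words (fdeg p1)) (u == q1)%:R *
    (\sum_(v <- words (fdeg p2)) (v == q2)%:R * c u v)).
  apply: eq_bigr => u _; rewrite raddf_sum mulr_sumr; apply: eq_bigr => v _.
  by rewrite /= mcoeffZ mcoeff_basis xpair_eqE -mulnb natrM mulrC -mulrA.
have := g _ _ _ (@TTdegU K _ q1 q2) => /TTdegP/(_ (p1, p2)) /=; rewrite -/(c q1 q2).
have [e1|n1] := eqVneq (fdeg p1) (fdeg q1); last first.
  move=> -> //; rewrite big1_seq // => u; rewrite mem_words /= => /eqP eu.
  have /negPf -> : u != q1 by apply: contra_neq n1 => <-.
  by rewrite mul0r.
rewrite sum_words_delta //.
have [e2 _|n2 -> //] := eqVneq (fdeg p2) (fdeg q2).
  by rewrite sum_words_delta.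
rewrite big1_seq // => v; rewrite mem_words /= => /eqP ev.
have /negPf -> : v != q2 by apply: contra_neq n2 => <-.
by rewrite mul0r.
Qed.

Lemma pairing_adjoint psi f t : linear psi -> graded psi ->
  pairing (adjoint psi f) t = pairing f (psi t).
Proof.
move=> l g; move: f t; apply: scalar_bilin_ext.
- by move=> t c f f'; rewrite adjoint_linear pairingPl.
- by move=> f c t t'; rewrite pairingPr.
- by move=> t c f f'; rewrite pairingPl.
- by move=> f c t t'; rewrite l pairingPr.
by move=> p q; rewrite pairingUr pairingUl adjointUE.
Qed.

Lemma adjoint_can psi psi' : C2_inverse psi psi' ->
  cancel (adjoint psi') (adjoint psi).
Proof.
move=> [l l' K1 K2 g g'] f; apply: pairing_inj => t.
by rewrite !pairing_adjoint // K1.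
Qed.

Lemma graded_adjoint psi : graded psi -> graded (adjoint psi).
Proof.
move=> g r s t ht.
apply: (lin_in (adjoint_linear psi) (TTdeg_subspace _ _)) => -[u v] /ht[/= hu hv].
apply/TTdegP => -[u' v'] h; rewrite adjointUE //.
have := g _ _ _ (@TTdegU K _ u' v') => /TTdegP; apply.
by rewrite /= hu hv eq_sym [s == _]eq_sym.
Qed.

(** The choices in [transpose] and in [inverse] are forced: the pairing
    separates points and [adjoint psi] is injective. *)
Lemma bangE psi psi' : C2_inverse psi psi' -> bang psi = adjoint psi'.
Proof.
move=> h; have [l l' K1 K2 g g'] := h; apply: funext => y.
have tE : transpose psi =1 adjoint psi.
  move=> f; apply: xget_unique => [t|g0 h0]; first exact: pairing_adjoint.
  by apply: pairing_inj => t; rewrite h0 pairing_adjoint.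
apply: xget_unique; first by rewrite /mkset tE (adjoint_can h).
by move=> x; rewrite /mkset tE => <-; rewrite (adjoint_can (C2_inverse_sym h)).
Qed.

Lemma C2_inverse_bang psi psi' : C2_inverse psi psi' ->
  C2_inverse (bang psi) (adjoint psi).
Proof.
move=> h; rewrite (bangE h); case: (h) => *.
split; try exact: adjoint_linear; try exact: graded_adjoint.
  exact: (adjoint_can h).
exact: (adjoint_can (C2_inverse_sym h)).
Qed.

Lemma C2_bang psi : C2 psi -> C2 (bang psi).
Proof.
by move=> /C2P[psi' /C2_inverse_bang h]; apply/C2P; exists (adjoint psi).
Qed.

(** Invariance of the pairing determines [bang psi] (see [bang_unique]) and
    serves as its working definition. *)
Lemma pairing_bang psi f t : C2 psi ->
  pairing (bang psi f) (psi t) = pairing f t.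
Proof.
move=> /C2P[psi' h]; have [l l' K1 K2 g g'] := h.
by rewrite (bangE h) pairing_adjoint // K1.
Qed.

Lemma bang_unique psi chi : C2 psi ->
  (forall f t, pairing (chi f) (psi t) = pairing f t) -> bang psi = chi.
Proof.
move=> Cpsi h; have /C2P[psi' [_ _ K1 K2 _ _]] := Cpsi.
apply: funext => f; apply: pairing_inj => t.
by rewrite -[t]K2 pairing_bang // h.
Qed.

End Transpose.

(** * The pairing degree by degree *)

Section GradedPairing.
Context {K : fieldType} {I : finType}.
Local Notation T := (tensor_alg K I).
Local Notation TT := (tensor_alg2 K I).
Implicit Types (psi : TT -> TT).

Lemma pairing_scalar (G : choiceType) (f : {malg K[G]}) : scalar (pairing f).
Proof. by move=> c x y; rewrite pairingPr. Qed.

Lemma pairing_TTdeg0 r s r' s' (f t : TT) : TTdeg r s f -> TTdeg r' s' t ->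
  (r' != r) || (s' != s) -> pairing f t = 0.
Proof.
move=> hf ht h; apply: (scalar_eq_in (f := pairing f) (g := fun=> 0)) => //.
- exact: pairing_scalar.
- by move=> c x y; rewrite mulr0 addr0.
move=> [u v] /ht[/= ru sv]; rewrite pairingUr.
by move/TTdegP: hf; apply; rewrite /= ru sv.
Qed.

Lemma pairing_Tdeg0 m n (f x : T) : Tdeg m f -> Tdeg n x -> n != m ->
  pairing f x = 0.
Proof.
move=> hf hx h; apply: (scalar_eq_in (f := pairing f) (g := fun=> 0)) => //.
- exact: pairing_scalar.
- by move=> c y z; rewrite mulr0 addr0.
by move=> u /hx e; rewrite pairingUr; move/TdegP: hf; apply; rewrite e.
Qed.

Lemma pairing_inj_in n (f g : T) : Tdeg n f -> Tdeg n g ->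
  (forall x, Tdeg n x -> pairing f x = pairing g x) -> f = g.
Proof.
move=> hf hg h; apply/malgP => w; rewrite -!pairingUr.
have [e|e] := eqVneq (fdeg w) n; first exact/h/TdegU_of.
by rewrite !(pairing_Tdeg0 _ (TdegU w) e).
Qed.

Lemma tmul_onto r s (x : T) :
  Tdeg (r + s) x -> exists2 t : TT, TTdeg r s t & tmul t = x.
Proof.
move=> hx; pose f (w : {fmonom I}) : TT :=
  << (FMonom (take r w), FMonom (drop r w)) >>.
exists (linext f x).
  apply: (lin_in (@linext_is_linear _ _ _ f) (TTdeg_subspace _ _)) => w /hx.
  rewrite fdegE => e; rewrite linextU /f.
  have := @TTdegU K I (FMonom (take r w)) (FMonom (drop r w)).
  by rewrite !fdegE /= size_drop size_takel e ?addKn ?leq_addr.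
apply: (malg_eq_lin (f := fun x => tmul (linext f x)) (g := fun x => x)) => //.
  by apply: lin_comp; [exact: tmul_linear|exact: linext_is_linear].
move=> w; rewrite linextU /tmul linextU /=; congr << _ >>.
by apply/eqP; rewrite fmP fmM /= cat_take_drop.
Qed.

Lemma C2_onto psi r s t : C2 psi -> TTdeg r s t ->
  exists2 t', TTdeg r s t' & psi t' = t.
Proof. by case=> _ _ im; rewrite -{1}im => -[t' ? <-]; exists t'. Qed.

Lemma C2_TTdeg psi : C2 psi -> graded psi.
Proof. by move=> /C2P[psi' []]. Qed.

Lemma C2_linear psi : C2 psi -> linear psi.
Proof. by case. Qed.

Lemma Tdeg1 : Tdeg 0 (1 : T).
Proof. by have := TdegU (K := K) (mone : {fmonom I}); rewrite fdeg1. Qed.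

End GradedPairing.

(** * Duality of cocycles *)

Section BangCocycle.
Context {K : fieldType} {I : finType}.
Local Notation T := (tensor_alg K I).
Local Notation TT := (tensor_alg2 K I).
Implicit Types (psi : TT -> TT).

(** The products twisted by [bang psi] and by [psi] are dual to each other, as
    [bang psi] and [psi] preserve the pairing and multiplication does so in a
    fixed bidegree. *)
Lemma pairing_cochain psi r s (f g x y : T) : C2 psi ->
  Tdeg r f -> Tdeg s g -> Tdeg r x -> Tdeg s y ->
  pairing (cochain_mul (bang psi) f g) (cochain_mul psi x y) =
  pairing f x * pairing g y.
Proof.
move=> Cpsi hf hg hx hy; rewrite /cochain_mul (@pairing_tmul _ _ r s).
- by rewrite pairing_bang // pairing_tens.
- by apply: (C2_TTdeg (C2_bang Cpsi)); apply: TTdeg_tens.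
- by apply: (C2_TTdeg Cpsi); apply: TTdeg_tens.
Qed.

Lemma C2_cochain_deg psi r s (x y : T) : C2 psi ->
  Tdeg r x -> Tdeg s y -> Tdeg (r + s) (cochain_mul psi x y).
Proof.
by move=> Cpsi hx hy; apply/Tdeg_tmul/(C2_TTdeg Cpsi)/TTdeg_tens.
Qed.

(** Twisted products fill degree r + s: [psi] is onto in bidegree (r, s), and
    every word of length r + s is a concatenation of words of lengths r and s. *)
Lemma cochain_eq_in psi r s (f g : T -> K) : C2 psi -> scalar f -> scalar g ->
  (forall x y, Tdeg r x -> Tdeg s y ->
     f (cochain_mul psi x y) = g (cochain_mul psi x y)) ->
  forall z, Tdeg (r + s) z -> f z = g z.
Proof.
move=> Cpsi lf lg h z /tmul_onto[t /(C2_onto Cpsi)[t' ht' <-] <-].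
have lpsi := C2_linear Cpsi.
apply: (scalar_eq_in (f := fun t => f (tmul (psi t)))
  (g := fun t => g (tmul (psi t)))) => [c x y|c x y|].
- by rewrite lpsi tmulP lf.
- by rewrite lpsi tmulP lg.
by move=> [u v] /ht'[/= ru sv]; rewrite -tensUU; apply: h; apply: TdegU_of.
Qed.

(** Paired with a twisted product of x, y, z, either bracketing of f, g, h
    gives <f, x> <g, y> <h, z>, because the twisted product of x, y, z is
    associative. Such products fill their degree, where the pairing is
    nondegenerate. *)
Lemma cocycle_bang psi : Z2 psi -> cocycle (bang psi).
Proof.
move=> Zpsi; have [Cpsi Apsi _] := Zpsi; have Cb := C2_bang Cpsi.
move=> r s t f g h hf hg hh.
have hfg := C2_cochain_deg Cb hf hg; have hgh := C2_cochain_deg Cb hg hh.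
apply: (@pairing_inj_in _ _ (r + s + t)).
- exact: C2_cochain_deg.
- by rewrite -addnA; exact: C2_cochain_deg.
apply: (cochain_eq_in Cpsi); try exact: pairing_scalar.
move=> xy z hxy hz.
have lz := @cochain_mul_linearl _ _ _ Zpsi z.
apply: (cochain_eq_in (f := fun w => pairing _ (cochain_mul psi w z))
  (g := fun w => pairing _ (cochain_mul psi w z)) Cpsi _ _ _ hxy).
- by move=> c a b; rewrite lz pairingPr.
- by move=> c a b; rewrite lz pairingPr.
move=> x y hx hy; have hyz := C2_cochain_deg Cpsi hy hz.
have hxy' := C2_cochain_deg Cpsi hx hy.
have := pairing_cochain Cpsi hfg hh hxy' hz.
have := pairing_cochain Cpsi hf hgh hx hyz.
have := pairing_cochain Cpsi hg hh hy hz.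
have := pairing_cochain Cpsi hf hg hx hy.
have := Apsi r s t x y z hx hy hz.
move: (cochain_mul psi) (cochain_mul (bang psi)) => m n <- -> -> -> ->.
by rewrite mulrA.
Qed.

(** Preserving the pairing reduces the claim to: [tens 1 f] takes the same
    values on t and on [psi t]. In bidegree (0, s) this is the counit law of
    [psi], and in the other bidegrees both values vanish. *)
Lemma counital_bang psi : Z2 psi -> counital (bang psi).
Proof.
move=> [Cpsi _ Upsi] f.
have /C2P[psi' [lpsi _ K1 K2 _ _]] := Cpsi.
have T0 : Tdeg 0 (1 : T) by exact: Tdeg1.
have key (F : TT) :
    (forall u v, pairing F << (u, v) >> = pairing F (psi << (u, v) >>)) ->
    bang psi F = F.
  move=> h; apply: pairing_inj => t; rewrite -[t]K2 pairing_bang //.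
  apply: (scalar_eq_in (f := pairing F) (g := fun t => pairing F (psi t))).
  - exact: pairing_scalar.
  - by move=> c x y; rewrite lpsi pairingPr.
  by case=> u v _; exact: h.
split; apply: key => u v.
- have [u0|u0] := eqVneq (fdeg u) 0%N.
    have -> : u = mone by apply/eqP; rewrite -fdeg_eq0 u0.
    by rewrite -tensUU (Upsi << v >>).1.
  have h t : TTdeg (fdeg u) (fdeg v) t -> pairing (tens 1 f) t = 0.
    move=> ht; apply: (scalar_eq_in (f := pairing _) (g := fun=> 0)) => //.
    - exact: pairing_scalar.
    - by move=> c x y; rewrite mulr0 addr0.
    move=> [a b] /ht[/= ea _]; rewrite -tensUU pairing_tens.
    by rewrite (pairing_Tdeg0 T0 (TdegU a)) ?mul0r // ea.
  by rewrite !h //; [exact/(C2_TTdeg Cpsi)/TTdegU|exact: TTdegU].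
- have [v0|v0] := eqVneq (fdeg v) 0%N.
    have -> : v = mone by apply/eqP; rewrite -fdeg_eq0 v0.
    by rewrite -tensUU (Upsi << u >>).2.
  have h t : TTdeg (fdeg u) (fdeg v) t -> pairing (tens f 1) t = 0.
    move=> ht; apply: (scalar_eq_in (f := pairing _) (g := fun=> 0)) => //.
    - exact: pairing_scalar.
    - by move=> c x y; rewrite mulr0 addr0.
    move=> [a b] /ht[/= _ eb]; rewrite -tensUU pairing_tens.
    by rewrite (pairing_Tdeg0 T0 (TdegU b)) ?mulr0 // eb.
  by rewrite !h //; [exact/(C2_TTdeg Cpsi)/TTdegU|exact: TTdegU].
Qed.

Lemma Z2_bang psi : Z2 psi -> Z2 (bang psi).
Proof.
move=> Zpsi; split; [|exact: cocycle_bang|exact: counital_bang].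
by case: Zpsi => ? _ _; exact: C2_bang.
Qed.

End BangCocycle.

(** * The isomorphism of the tensor algebra with its twist *)

Section TwistWords.
Context {K : fieldType} {I : finType}.
Local Notation T := (tensor_alg K I).
Local Notation TT := (tensor_alg2 K I).

Lemma twist_liftU (psi : TT -> TT) (w : {fmonom I}) :
  @twist_lift K I psi << w >> =
  foldr (fun i (y : T) => cochain_mul psi << fmu i >> y) 1 w.
Proof. exact: linextU. Qed.

Lemma fdeg1P (w : {fmonom I}) : fdeg w = 1%N -> exists i, w = fmu i.
Proof. by case: w => [[|i [|//]]]//= _; exists i; rewrite fmuE. Qed.

End TwistWords.

Section TwistLift.
Context {K : fieldType} {I : finType}.
Local Notation T := (tensor_alg K I).
Local Notation TT := (tensor_alg2 K I).
Context {psi : TT -> TT} (Zpsi : Z2 psi).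
Local Notation theta := (@twist_lift K I psi).

Let Cpsi : C2 psi. Proof. by case: Zpsi. Qed.

Lemma twist_lift1 : theta 1 = 1.
Proof. by rewrite -[1 in LHS]/(<< mone >> : T) /twist_lift linextU fm1. Qed.

Lemma twist_lift_gen i : theta << fmu i >> = << fmu i >>.
Proof. by rewrite /twist_lift linextU fmU /= (cochain_mul1r Zpsi). Qed.

(** Together with [twist_lift_gen] this identifies [twist_lift] as the algebra
    morphism from the tensor algebra to its twist that fixes the generators. *)
Lemma twist_liftM x y : theta (x * y) = cochain_mul psi (theta x) (theta y).
Proof.
have lt := @twist_lift_linear K I psi.
have cl := @cochain_mul_linearl _ _ _ Zpsi.
have cr := @cochain_mul_linearr _ _ _ Zpsi.
move: x y; apply: malg_bilin_ext.
- by move=> y c x x'; rewrite linE lt.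
- by move=> x c y y'; rewrite linE lt.
- by move=> y c x x'; rewrite lt cl.
- by move=> x c y y'; rewrite lt cr.
move=> u v; rewrite (malg_mulUU u v) (twist_liftU psi (mmul u v)).
rewrite (twist_liftU psi u) (twist_liftU psi v) fmM.
have [A1 A] := (cochain_mul1l Zpsi, cochain_mulA Zpsi).
move: (cochain_mul psi) A1 A => m A1 A.
elim: (u : seq I) => [|i s ih] /=; first by rewrite A1.
by rewrite ih A.
Qed.

(** V generates the twisted algebra: [psi] is onto in bidegree (1, n), which
    splits off one letter at a time. *)
Lemma twist_lift_onto n x : Tdeg n x -> exists2 y, Tdeg n y & theta y = x.
Proof.
have lt := @twist_lift_linear K I psi.
have sub m : subspace [set x | exists2 y, Tdeg m y & theta y = x].
  split; first by exists 0; [case: (@Tdeg_subspace K I m)|exact: lin0 lt].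
  move=> c _ _ [a ha <-] [b hb <-]; exists (c *: a + b); last by rewrite lt.
  by case: (@Tdeg_subspace K I m) => _; apply.
elim: n x => [|n ih] x hx.
  apply: (lin_in (f := fun x => x) (@lin_id _ _) (sub 0%N)) => u /hx u0.
  have -> : u = mone by apply/eqP; rewrite -fdeg_eq0 u0.
  by exists 1; [exact: Tdeg1|exact: twist_lift1].
have [t /(C2_onto Cpsi)[t' ht' <-] <-] := tmul_surj hx.
have lf : linear (fun t => tmul (psi t)).
  by apply: lin_comp; [exact: tmul_linear|exact: C2_linear].
apply: (lin_in lf (sub n.+1)) => -[u v] /ht'[/= hu hv].
have [y hy ey] := ih _ (TdegU_of hv).
exists (<< u >> * y); first by rewrite -add1n; apply: TdegM => //; apply: TdegU_of.
rewrite twist_liftM ey /cochain_mul -tensUU; congr (tmul (psi (tens _ _))).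
by have [i ->] := fdeg1P hu; exact: twist_lift_gen.
Qed.

(** By induction on words from [pairing_cochain], one letter at a time. It
    gives the injectivity of [twist_lift] and carries annihilators through the
    twist. *)
Lemma pairing_twist_lift f x :
  pairing (@twist_lift K I (bang psi) f) (theta x) = pairing f x.
Proof.
have Zb := Z2_bang Zpsi.
have lt := @twist_lift_linear K I psi.
have lb := @twist_lift_linear K I (bang psi).
move: f x; apply: scalar_bilin_ext.
- by move=> y c x x'; rewrite lb pairingPl.
- by move=> x c y y'; rewrite lt pairingPr.
- by move=> y c x x'; rewrite pairingPl.
- by move=> x c y y'; rewrite pairingPr.
move=> u v; have [e|e] := eqVneq (fdeg v) (fdeg u); last first.
  rewrite (pairing_Tdeg0 (TdegU u) (TdegU v) e).
  by apply: (pairing_Tdeg0 _ _ e); apply: Tdeg_twist_lift => //; apply: TdegU.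
rewrite (twist_liftU (bang psi) u) (twist_liftU psi v) pairingUr mcoeff_basis fmP.
have hd (chi : TT -> TT) (Zc : Z2 chi) (w : seq I) : Tdeg (size w)
    (foldr (fun i (x : T) => cochain_mul chi << fmu i >> x) 1 w).
  elim: w => [|i w ih]; first exact: Tdeg1.
  exact: (Tdeg_cochain_mul Zc (TdegU_of (fdegU i)) ih).
have P i j s (g y : T) : Tdeg s g -> Tdeg s y ->
    pairing (cochain_mul (bang psi) << fmu i >> g) (cochain_mul psi << fmu j >> y)
    = (i == j)%:R * pairing g y.
  move=> hg hy; have h1 k : Tdeg 1 (<< fmu k >> : T) by apply: TdegU_of; apply: fdegU.
  rewrite (pairing_cochain Cpsi (h1 i) hg (h1 j) hy); congr (_ * _).
  by rewrite pairingUr mcoeff_basis fmP !fmU eqseq_cons andbT.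
have := hd _ Zb; have := hd _ Zpsi; clear hd; move: P e; rewrite !fdegE.
move: (u : seq I) (v : seq I) => {}u {}v.
move: (cochain_mul psi) (cochain_mul (bang psi)) => m n P e hm hn.
elim: u v e => [|i u ih] [|j v] // => [_|[e]].
  by apply: (etrans (pairingUr (<< mone >> : T) mone)); rewrite mcoeff_basis !eqxx.
by rewrite (P i j (size u)) ?ih // -?e // eqseq_cons -mulnb natrM.
Qed.

Lemma twist_lift_inj : injective theta.
Proof.
move=> x y e; apply: pairing_injr => f.
by rewrite -(pairing_twist_lift f x) -(pairing_twist_lift f y) e.
Qed.

End TwistLift.

(** * Subspaces stable under a cochain *)

Section SideTensors.
Context {K : fieldType} {I : finType}.
Local Notation T := (tensor_alg K I).
Local Notation TT := (tensor_alg2 K I).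
Implicit Types (psi : TT -> TT) (X : set T).

(** The left and right conditions of 2nd admissibility are treated at once:
    [l] tells whether c is the left factor. *)
Definition otens (l : bool) (c y : T) : TT := if l then tens c y else tens y c.

Definition TTside (l : bool) s m : set TT := if l then TTdeg s m else TTdeg m s.

Definition sandwich p X r : set T := mulsp (mulsp (Tdeg p) X) (Tdeg r).

(** The subspaces V^s (x) (V^p X V^r), or (V^p X V^r) (x) V^s, that 2nd
    admissibility speaks of, given by spanning vectors. *)
Definition slab l s p X r : set TT := lspan [set t | exists c a x b,
  [/\ Tdeg s c, Tdeg p a, X x & Tdeg r b] /\ t = otens l c (a * x * b)].

Lemma otensPl l c (x x' y : T) :
  otens l (c *: x + x') y = c *: otens l x y + otens l x' y.
Proof. by case: l; rewrite /otens linE. Qed.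

Lemma otensPr l c (x y y' : T) :
  otens l x (c *: y + y') = c *: otens l x y + otens l x y'.
Proof. by case: l; rewrite /otens linE. Qed.

Lemma TTside_otens l s m (c y : T) : Tdeg s c -> Tdeg m y ->
  TTside l s m (otens l c y).
Proof. by case: l => hc hy; apply: TTdeg_tens. Qed.

Lemma TTside_subspace l s m : subspace (TTside l s m).
Proof. by case: l; apply: TTdeg_subspace. Qed.

Lemma otensUU l (u v : {fmonom I}) :
  otens l << u >> << v >> = << if l then (u, v) else (v, u) >>.
Proof. by case: l; rewrite /otens tensUU. Qed.

Lemma pairing_otens l (c y c' y' : T) :
  pairing (otens l c y) (otens l c' y') = pairing c c' * pairing y y'.
Proof. by case: l; rewrite /otens pairing_tens // mulrC. Qed.

Lemma slabP l s p X r (S : set TT) : subspace S ->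
  (forall c a x b, Tdeg s c -> Tdeg p a -> X x -> Tdeg r b ->
     S (otens l c (a * x * b))) ->
  slab l s p X r `<=` S.
Proof.
move=> sS h; apply: lspan_min => // _ [c [a [x [b [[? ? ? ?] ->]]]]].
exact: h.
Qed.

Lemma mem_slab l s p X r c a x b : Tdeg s c -> Tdeg p a -> X x -> Tdeg r b ->
  slab l s p X r (otens l c (a * x * b)).
Proof. by move=> ? ? ? ?; apply: sub_lspan; exists c, a, x, b. Qed.

Lemma slabE l s p X r :
  slab l s p X r = lspan [set otens l c y | c in Tdeg s & y in sandwich p X r].
Proof.
apply/seteqP; split.
  apply: slabP => [|c a x b hc ha hx hb]; first exact: lspan_subspace.
  apply: sub_lspan; exists c => //; exists (a * x * b) => //.
  apply: sub_lspan; exists (a * x) => //; last by exists b.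
  by apply: sub_lspan; exists a => //; exists x.
have sS := @lspan_subspace K TT.
apply: lspan_min; first exact: sS.
move=> _ [c hc [y hy <-]].
apply: (lspan_image (f := otens l c) _ (sS _) _ hy).
  by move=> k z z'; apply: otensPr.
move=> _ [z hz [b hb <-]].
apply: (lspan_image (f := fun z => otens l c (z * b)) _ (sS _) _ hz).
  by move=> k t t'; rewrite malg_mulPl otensPr.
by move=> _ [a ha [x hx <-]]; apply: mem_slab.
Qed.

Lemma tensp_slabl s p X r : tensp (Tdeg s) (sandwich p X r) = slab true s p X r.
Proof. by rewrite slabE. Qed.

Lemma tensp_slabr s p X r : tensp (sandwich p X r) (Tdeg s) = slab false s p X r.
Proof.
rewrite slabE.
apply/seteqP; split; apply: lspan_min; try exact: lspan_subspace.
  by move=> _ [y hy [c hc <-]]; apply: sub_lspan; exists c => //; exists y.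
by move=> _ [c hc [y hy <-]]; apply: sub_lspan; exists y => //; exists c.
Qed.

(** 2nd admissibility with one subspace X in place of the homogeneous parts of
    an ideal. In this form it passes to annihilators and to tensor products of
    subspaces, which need not be the homogeneous parts of an ideal, and it is what
    twisting the ideal generated by X uses. *)
Definition stable psi X := forall l s p r,
  psi @` slab l s p X r = slab l s p X r.

Lemma admissible2_stable (A : qspace K I) psi n :
  admissible2 A psi -> stable psi (hideal A n).
Proof.
move=> h l s p r; have [h1 h2] := h p n r s.
by case: l; rewrite -?tensp_slabl -?tensp_slabr.
Qed.

Lemma slab_deg l s p X r n : X `<=` Tdeg n ->
  slab l s p X r `<=` TTside l s (p + n + r).
Proof.
move=> hX; apply: slabP => [|c a x b hc ha /hX hx hb]; first exact: TTside_subspace.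
by apply: TTside_otens => //; apply: TdegM => //; apply: TdegM.
Qed.

Lemma word_split3 p n r (v : {fmonom I}) : fdeg v = (p + n + r)%N ->
  exists a w b, [/\ fdeg a = p, fdeg w = n, fdeg b = r &
    v = mmul (mmul a w) b].
Proof.
rewrite fdegE => e; exists (FMonom (take p v)), (FMonom (take n (drop p v))),
  (FMonom (drop n (drop p v))).
rewrite !fdegE /= !size_drop !size_takel ?size_drop ?e; first last.
- by rewrite -addnA leq_addr.
- by rewrite -addnA addKn leq_addr.
split=> //; first by rewrite -addnA !addKn.
by apply/eqP; rewrite fmP !fmM /= -catA !cat_take_drop.
Qed.

Lemma pairing_sandwich p n r (a f b a' x b' : T) :
  Tdeg p a -> Tdeg n f -> Tdeg r b -> Tdeg p a' -> Tdeg n x -> Tdeg r b' ->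
  pairing (a * f * b) (a' * x * b') = pairing a a' * pairing f x * pairing b b'.
Proof.
move=> ha hf hb ha' hx hb'.
rewrite (pairing_mul (TdegM ha hf) hb (TdegM ha' hx) hb').
by rewrite (pairing_mul ha hf ha' hx).
Qed.

Lemma TTsideP l s m (t : TT) : TTside l s m t <-> forall u v,
  (fdeg u != s) || (fdeg v != m) -> t@_(if l then (u, v) else (v, u)) = 0.
Proof.
split.
  by case: l => /TTdegP h u v huv; apply: h => //=; rewrite orbC.
by case: l => h; apply/TTdegP => -[u v] /= huv; apply: h; rewrite // orbC.
Qed.

(** The slab of an annihilator is the annihilator of the slab. An element f of
    the latter is expanded along its letters outside the n middle ones; the
    coefficients have degree n, and they kill X because f kills the slab of X. *)
Lemma slab_annihilator l s p X r n : (2 <= n)%N -> X `<=` Tdeg n ->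
  slab l s p (annihilator n X) r = [set f | TTside l s (p + n + r) f /\
    forall t, slab l s p X r t -> pairing f t = 0].
Proof.
move=> n2 hX.
have AE : annihilator n X = [set f | Tdeg n f /\ forall x, X x -> pairing f x = 0].
  by rewrite /annihilator n2.
have hA : annihilator n X `<=` Tdeg n by rewrite AE => f [].
apply/seteqP; split.
  apply: slabP => [|c a f b hc ha]; rewrite ?AE.
    split; first split.
    - by case: (TTside_subspace l s (p + n + r)).
    - by move=> t _; exact: (lin0 (pairing_linearl t)).
    move=> k f g [hf Hf] [hg Hg]; split.
      by case: (TTside_subspace l s (p + n + r)) => _; apply.
    by move=> t ht; rewrite pairingPl Hf // Hg // mulr0 addr0.
  move=> [hf Hf] hb; split.
    by apply: TTside_otens => //; apply: TdegM => //; apply: TdegM.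
  apply: slabP => [|c' a' x b' hc' ha' Xx hb'].
    split; first exact: pairing0.
    by move=> k t t' /= e e'; rewrite pairingPr e e' mulr0 addr0.
  rewrite /mkset pairing_otens (pairing_sandwich ha hf hb ha' (hX _ Xx) hb').
  by rewrite (Hf _ Xx) mulr0 mul0r mulr0.
move=> f [hf Hf].
pose q (c v : {fmonom I}) := if l then (c, v) else (v, c).
(* The component of f with c on the side and a, b around the middle
   letters. *)
pose g (c a b : {fmonom I}) : T :=
  \sum_(w <- words n) f@_(q c (mmul (mmul a w) b)) *: << w >>.
have gE c a b w : fdeg w = n -> (g c a b)@_w = f@_(q c (mmul (mmul a w) b)).
  move=> hw; rewrite /g raddf_sum.
  rewrite -(sum_words_delta (fun w => f@_(q c (mmul (mmul a w) b))) hw).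
  apply: eq_bigr => v _.
  by rewrite /= mcoeffZ mcoeff_basis mulrC.
have gdeg c a b : Tdeg n (g c a b).
  apply: (subspace_sum (Tdeg_subspace n)) => w; rewrite mem_words => /eqP hw.
  by apply: (subspaceZ _ (Tdeg_subspace n)); apply: TdegU_of.
have gann c a b : fdeg c = s -> fdeg a = p -> fdeg b = r ->
    annihilator n X (g c a b).
  move=> hc ha hb; rewrite AE; split=> [|x Xx]; first exact: gdeg.
  rewrite -(Hf (otens l << c >> (<< a >> * x * << b >>))); last first.
    by apply: mem_slab => //; apply: TdegU_of.
  apply: (scalar_eq_in (f := pairing _)
    (g := fun x => pairing f (otens l << c >> (<< a >> * x * << b >>)))).
  - exact: pairing_scalar.
  - by move=> k y z; rewrite malg_mulPr malg_mulPl otensPr pairingPr.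
  move=> w /(hX _ Xx) hw; rewrite pairingUr gE // !malg_mulUU otensUU.
  by rewrite pairingUr.
pose h (c a b : {fmonom I}) : TT := otens l << c >> (<< a >> * g c a b * << b >>).
pose F : TT := \sum_(c <- words s) \sum_(a <- words p) \sum_(b <- words r) h c a b.
have FS : slab l s p (annihilator n X) r F.
  apply: (subspace_sum (lspan_subspace _)) => c; rewrite mem_words => /eqP hc.
  apply: (subspace_sum (lspan_subspace _)) => a; rewrite mem_words => /eqP ha.
  apply: (subspace_sum (lspan_subspace _)) => b; rewrite mem_words => /eqP hb.
  by apply: mem_slab; [exact: TdegU_of|exact: TdegU_of|exact: gann|exact: TdegU_of].
suff -> : f = F by [].
have hF : TTside l s (p + n + r) F := slab_deg hA FS.
suff key u v : f@_(q u v) = F@_(q u v).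
  apply/malgP => -[u v]; rewrite /q in key.
  by case: (l) key => key; [exact: (key u v)|exact: (key v u)].
have [huv|] := boolP ((fdeg u != s) || (fdeg v != (p + n + r)%N)).
  by move/TTsideP: hF => -> //; move/TTsideP: hf => ->.
rewrite negb_or !negbK => /andP[/eqP hu /eqP hv].
have [a [w [b [ha hw hb ev]]]] := word_split3 hv.
have hh c' a' b' : fdeg c' = s -> fdeg a' = p -> fdeg b' = r ->
    (h c' a' b')@_(q u v) =
    (c' == u)%:R * ((a' == a)%:R * ((b' == b)%:R * (g c' a' b')@_w)).
  move=> hc' ha' hb'; rewrite -pairingUr /q -otensUU ev -!malg_mulUU pairing_otens.
  rewrite (pairing_sandwich (TdegU_of ha') (gdeg _ _ _) (TdegU_of hb')
    (TdegU_of ha) (TdegU_of hw) (TdegU_of hb)).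
  by rewrite !pairingUr !mcoeff_basis -mulrA [_ * (b' == b)%:R]mulrC.
rewrite ev -gE // -ev -[LHS](sum_words_delta (fun c => (g c a b)@_w) hu).
rewrite raddf_sum; apply: eq_big_seq => c; rewrite mem_words => /eqP hc.
rewrite -[in LHS](sum_words_delta (fun a => (g c a b)@_w) ha) mulr_sumr raddf_sum.
apply: eq_big_seq => a'; rewrite mem_words => /eqP ha'.
rewrite -[in LHS](sum_words_delta (fun b => (g c a' b)@_w) hb) !mulr_sumr raddf_sum.
apply: eq_big_seq => b'; rewrite mem_words => /eqP hb'.
by apply/esym/hh.
Qed.

Lemma stable0 psi : linear psi -> stable psi [set 0].
Proof.
move=> lpsi l s p r.
have -> : slab l s p [set 0] r = [set 0].
  apply/seteqP; split; last by move=> _ ->; case: (lspan_subspace (K := K)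
    [set t | exists c a x b, [/\ Tdeg s c, Tdeg p a, [set 0] x & Tdeg r b] /\
      t = otens l c (a * x * b)]).
  apply: slabP => [|c a x b _ _ -> _].
    by split=> // k t t' /= -> ->; rewrite scaler0 addr0.
  by rewrite mulr0 mul0r; apply: (lin0 (f := otens l c)) => k t t'; apply: otensPr.
by rewrite image_set1 (lin0 lpsi).
Qed.

(** As [bang psi] and [psi] preserve the pairing, [bang psi] preserves the
    annihilator of each slab that [psi] preserves. *)
Lemma stable_bang psi X n : C2 psi -> X `<=` Tdeg n -> stable psi X ->
  stable (bang psi) (annihilator n X).
Proof.
move=> Cpsi hX sX; have Cb := C2_bang Cpsi.
have [n2|n2] := leqP 2 n; last first.
  by rewrite /annihilator leqNgt n2 /=; apply: stable0; exact: C2_linear.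
move=> l s p r; rewrite slab_annihilator //.
have side chi t m : C2 chi -> TTside l s m t -> TTside l s m (chi t).
  by move=> Cc; case: (l) => ?; apply: (C2_TTdeg Cc).
apply/seteqP; split=> [_ [f [hf Hf] <-]|f [hf Hf]].
  split; first exact: side.
  by move=> t; rewrite -(sX l s p r) => -[u hu <-]; rewrite pairing_bang // Hf.
have [g hg eg] : exists2 g, TTside l s (p + n + r) g & bang psi g = f.
  by move: hf; rewrite /TTside; case: (l) => /(C2_onto Cb).
exists g => //; split=> // t ht.
by rewrite -(pairing_bang _ _ Cpsi) eg Hf // -(sX l s p r); exists t.
Qed.

End SideTensors.

(** * Twisting ideals generated by stable subspaces *)

Section TwistedIdeals.
Context {K : fieldType} {I : finType}.
Local Notation T := (tensor_alg K I).
Local Notation TT := (tensor_alg2 K I).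
Implicit Types (psi : TT -> TT) (X : set T).

Lemma twist_hideal (A : qspace K I) psi (Zpsi : Z2 psi) (Apsi : admissible A psi) n :
  @twist_lift K I psi @` hideal (twist Zpsi Apsi) n = hideal A n.
Proof.
apply/seteqP; split=> [_ [y [hy ny] <-]|x [hx nx]].
  split; last exact: Tdeg_twist_lift.
  by rewrite /qideal /mkset -(canon_twist Zpsi Apsi).
have [y ny ey] := twist_lift_onto Zpsi nx; exists y => //; split=> //.
by rewrite /qideal /mkset (canon_twist Zpsi Apsi) ey.
Qed.

Lemma twist_annihilator psi n X X' : Z2 psi ->
  @twist_lift K I psi @` X' = X ->
  @twist_lift K I (bang psi) @` annihilator n X' = annihilator n X.
Proof.
move=> Zpsi <-; have Zb := Z2_bang Zpsi.
rewrite /annihilator; case: ifP => _; last first.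
  by rewrite image_set1 (lin0 (@twist_lift_linear K I (bang psi))).
apply/seteqP; split=> [_ [f [nf hf] <-]|f [nf hf]].
  split; first exact: Tdeg_twist_lift.
  by move=> _ [x hx <-]; rewrite (pairing_twist_lift Zpsi) hf.
have [g ng eg] := twist_lift_onto Zb nf; exists g => //; split=> // x hx.
by rewrite -(pairing_twist_lift Zpsi) eg hf //; exists x.
Qed.

Lemma mulr_sandwich (R : pzRingType) (c a x b : R) : c * (a * x * b) = c * a * x * b.
Proof. by rewrite !mulrA. Qed.

Lemma ideal_gen_span X (S : set T) : subspace S ->
  (forall u v x, X x -> S (<< u >> * x * << v >>)) -> ideal_gen X `<=` S.
Proof.
move=> sS h.
pose M := lspan [set z | exists a x b, X x /\ z = a * x * b].
have sM : subspace M by exact: lspan_subspace.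
have MS : M `<=` S.
  apply: lspan_min => // _ [a [x [b [Xx ->]]]].
  apply: (lin_in (f := fun a => a * x * b) _ sS) => [c y z|u _].
    by rewrite !malg_mulPl.
  apply: (lin_in (f := fun b => << u >> * x * b) _ sS) => [c y z|v _].
    by rewrite malg_mulPr.
  exact: h.
move=> z; move/(_ M) => hz; apply: MS; apply: hz; split; last first.
  move=> x Xx; apply: sub_lspan; exists 1, x, 1.
  by split; [exact: Xx|rewrite mulr1 mul1r].
split=> // c y hy; split.
  apply: (lspan_image (malg_mulr_linear c) sM _ hy) => _ [a [x [b [Xx ->]]]].
  apply: sub_lspan; exists (c * a), x, b; split; first exact: Xx.
  exact: mulr_sandwich.
apply: (lspan_image (malg_mull_linear c) sM _ hy) => _ [a [x [b [Xx ->]]]].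
apply: sub_lspan; exists a, x, (b * c); split; first exact: Xx.
exact/esym/mulrA.
Qed.

Lemma Tdeg0_scalar (x : T) : Tdeg 0 x -> x = x@_mone *: 1.
Proof.
move=> /TdegP x0; apply/malgP => w; rewrite mcoeffZ mcoeff1.
have [->|w1] := eqVneq w mone; first by rewrite mulr1.
by rewrite mulr0 x0 // fdeg_eq0.
Qed.

Lemma image_linear_subspace (U W : lmodType K) (f : U -> W) (S : set U) :
  linear f -> subspace S -> subspace (f @` S).
Proof.
move=> lf [S0 hS]; split; first by exists 0 => //; exact: lin0 lf.
move=> c _ _ [x hx <-] [y hy <-]; exists (c *: x + y); last by rewrite lf.
exact: hS.
Qed.

(** Expands ker Pi (x) T + T (x) ker Pi along the generators of the ideal and
    the words around them. *)
Lemma ker2_slabs (D : qspace K I) (P : set nat) (X : nat -> set T) :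
  qideal D = ideal_gen (\bigcup_(n in P) X n) ->
  ker2 D = lspan [set t | exists l s p n r, P n /\ slab l s p (X n) r t].
Proof.
move=> eD; set Y := [set t | _]; have sY : subspace (lspan Y) by exact: lspan_subspace.
apply/seteqP; split.
  rewrite ker2E; apply: lspan_min => //.
  suff key l x y : qideal D x -> lspan Y (otens l y x).
    by move=> _ [x [y [[h|h] ->]]]; [exact: (key false)|exact: (key true)].
  rewrite eD => hx; apply: (lin_in (f := fun y => otens l y x) _ sY) => [c z z'|w _].
    exact: otensPl.
  apply: (ideal_gen_span (S := [set x | lspan Y (otens l << w >> x)]) _ _ hx).
    split; first by rewrite /mkset (lin0 (f := otens l << w >>)) => [|c z z'];
      [case: sY|exact: otensPr].
    by move=> c z z'; rewrite /mkset otensPr; case: sY => _; apply.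
  move=> u v z [n Pn Xz]; apply: sub_lspan.
  exists l, (fdeg w), (fdeg u), n, (fdeg v); split=> //.
  by apply: mem_slab => //; apply: TdegU.
apply: lspan_min; first exact: ker2_subspace.
move=> t [l [s [p [n [r [Pn]]]]]].
apply: slabP => [|c a x b _ _ Xx _]; first exact: ker2_subspace.
have hx : qideal D (a * x * b).
  have [_ iD] := qideal_ideal D; apply: (iD b _ _).2; apply: (iD a _ _).1.
  by rewrite eD; apply: sub_ideal_gen; exists n.
rewrite ker2E; apply: sub_lspan; case: l.
  by exists c, (a * x * b); split=> //; right.
by exists (a * x * b), c; split=> //; left.
Qed.

Lemma stable_admissible (D : qspace K I) psi (P : set nat) (X : nat -> set T) :
  linear psi -> (forall n, P n -> stable psi (X n)) ->
  qideal D = ideal_gen (\bigcup_(n in P) X n) -> admissible D psi.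
Proof.
move=> lpsi st /ker2_slabs eD; rewrite /admissible eD; set Y := [set t | _].
have sY : subspace (lspan Y) by exact: lspan_subspace.
apply/seteqP; split=> [_ [t ht <-]|].
  apply: (lspan_image lpsi sY _ ht) => u [l [s [p [n [r [Pn hu]]]]]].
  apply: sub_lspan; exists l, s, p, n, r; split=> //.
  by rewrite -(st n Pn l s p r); exists u.
apply: lspan_min; first exact: image_linear_subspace.
move=> u [l [s [p [n [r [Pn]]]]]]; rewrite -(st n Pn) => -[t ht <-].
by exists t => //; apply: sub_lspan; exists l, s, p, n, r.
Qed.

Lemma tmul_otens_mul1l (a y b : T) : tmul (otens true a (1 * y * b)) = a * y * b.
Proof. by rewrite /otens tmul_tens mul1r mulrA. Qed.

Lemma tmul_otens_mulr1 (y b : T) : tmul (otens false b (y * 1)) = y * b.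
Proof. by rewrite /otens tmul_tens mulr1. Qed.

(** Stability converts ordinary products into twisted ones: since [psi] maps
    slabs of X onto themselves, products of words with X are combinations of
    twisted products of homogeneous elements with X, and twisted products of
    images of J are images of products in J. *)
Lemma twist_lift_image_closed psi (J X : set T) : Z2 psi -> stable psi X -> is_ideal J ->
  X `<=` @twist_lift K I psi @` J ->
  forall u v x, X x -> (@twist_lift K I psi @` J) (<< u >> * x * << v >>).
Proof.
move=> Zpsi st [sJ iJ] XJ u v x Xx; set S := _ @` J.
have sS : subspace S.
  by apply: image_linear_subspace => //; exact: twist_lift_linear.
have lpsi := Z2_linear Zpsi.
have lS : linear (fun t => tmul (psi t)).
  by apply: lin_comp; [exact: tmul_linear|].
have mem l n c z : Tdeg n c -> S z -> S (tmul (psi (otens l c z))).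
  move=> hc [y Jy <-]; have [c' _ <-] := twist_lift_onto Zpsi hc.
  case: l; rewrite /otens -/(cochain_mul _ _ _) -(twist_liftM Zpsi).
    by exists (c' * y) => //; apply: (iJ c' _ Jy).1.
  by exists (y * c') => //; apply: (iJ c' _ Jy).2.
have step l s p r : (forall a y b, Tdeg p a -> X y -> Tdeg r b -> S (a * y * b)) ->
    forall t, slab l s p X r t -> S (tmul t).
  move=> h t; rewrite -(st l s p r) => -[t' ht' <-]; move: t' ht'.
  apply: slabP => [|c a y b hc ha Xy hb].
    split; first by rewrite /mkset (lin0 lS); case: sS.
    by move=> k y z; rewrite /mkset lS; case: sS => _; apply.
  by apply: (mem l _ _ _ hc); apply: h.
(* [step] is used twice: once the word v is split off on the right and then
   the word u on the left, only scalars remain around X. *)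
have S0 a y b : Tdeg 0 a -> X y -> Tdeg 0 b -> S (a * y * b).
  move=> /Tdeg0_scalar -> Xy /Tdeg0_scalar ->.
  rewrite malg_scalerAr mulr1 -scalerAl mul1r.
  by do 2 apply: subspaceZ => //; apply: XJ.
have S1 a y b : Tdeg (fdeg u) a -> X y -> Tdeg 0 b -> S (a * y * b).
  move=> ha Xy hb.
  have <- : tmul (otens true a (1 * y * b)) = a * y * b.
    exact: tmul_otens_mul1l.
  have h : slab true (fdeg u) 0 X 0 (otens true a (1 * y * b)).
    by apply: mem_slab => //; exact: Tdeg1.
  exact: (step true (fdeg u) 0%N 0%N S0 _ h).
have <- : tmul (otens false << v >> (<< u >> * x * 1)) = << u >> * x * << v >>.
  exact: tmul_otens_mulr1.
have h : slab false (fdeg v) (fdeg u) X 0 (otens false << v >> (<< u >> * x * 1)).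
  by apply: mem_slab => //; [exact: TdegU|exact: TdegU|exact: Tdeg1].
exact: (step false (fdeg v) (fdeg u) 0%N S1 _ h).
Qed.

(** An ideal generated by stable subspaces is twisted by twisting its
    generators. The preimage of the ideal of D is an ideal containing the
    generators of C; the other inclusion is [twist_lift_image_closed]. *)
Lemma eq_twist_generated psi (C D : qspace K I) (P : set nat)
    (X' X : nat -> set T) : Z2 psi ->
  (forall n, P n -> stable psi (X n)) ->
  (forall n, P n -> @twist_lift K I psi @` X' n = X n) ->
  qideal C = ideal_gen (\bigcup_(n in P) X' n) ->
  qideal D = ideal_gen (\bigcup_(n in P) X n) ->
  eq_twist C D psi.
Proof.
move=> Zpsi st eX eC eD; have Dpsi := stable_admissible (Z2_linear Zpsi) st eD.
exists Zpsi, Dpsi; rewrite /same_qspace eC.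
have iJ : is_ideal (ideal_gen (\bigcup_(n in P) X' n)) by exact: ideal_gen_ideal.
apply/seteqP; split.
  move=> x hx; apply: hx; split; first exact: qideal_ideal.
  move=> y [n Pn Xy]; rewrite /qideal /mkset (canon_twist Zpsi Dpsi).
  suff : qideal D (@twist_lift K I psi y) by [].
  by rewrite eD; apply: sub_ideal_gen; exists n => //; rewrite -eX //; exists y.
move=> y; rewrite {1}/qideal /mkset (canon_twist Zpsi Dpsi) => hy.
have : qideal D (@twist_lift K I psi y) by [].
rewrite eD; set J := ideal_gen _ in iJ *.
have sS : subspace (@twist_lift K I psi @` J).
  by apply: image_linear_subspace; [exact: twist_lift_linear|case: iJ].
move=> /(ideal_gen_span sS) []; last by move=> z Jz /(twist_lift_inj Zpsi) <-.
move=> u v x [n Pn Xx]; apply: (twist_lift_image_closed Zpsi (st n Pn) iJ _ _ _ Xx).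
move=> z; rewrite -eX // => -[z' hz' <-]; exists z' => //.
by apply: sub_ideal_gen; exists n.
Qed.

End TwistedIdeals.

(** * Cocycles on tensor products *)

Section Jmap.
Context {K : fieldType} {I J : finType}.
Local Notation TI := (tensor_alg K I).
Local Notation TJ := (tensor_alg K J).
Local Notation TIJ := (tensor_alg K (I * J)%type).
Local Notation TTI := (tensor_alg2 K I).
Local Notation TTJ := (tensor_alg2 K J).
Local Notation TTIJ := (tensor_alg2 K (I * J)%type).

Definition fst_word (z : {fmonom (I * J)%type}) : {fmonom I} := FMonom (unzip1 z).
Definition snd_word (z : {fmonom (I * J)%type}) : {fmonom J} := FMonom (unzip2 z).

Lemma fdeg_fst z : fdeg (fst_word z) = fdeg z.
Proof. by rewrite !fdegE size_map. Qed.

Lemma fdeg_snd z : fdeg (snd_word z) = fdeg z.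
Proof. by rewrite !fdegE size_map. Qed.

Lemma fzip_words z : fzip (fst_word z) (snd_word z) = z.
Proof. by apply/eqP; rewrite fmP /= zip_unzip. Qed.

Lemma fst_fzip (u : {fmonom I}) (v : {fmonom J}) :
  fdeg u = fdeg v -> fst_word (fzip u v) = u.
Proof.
by rewrite !fdegE => e; apply/eqP; rewrite fmP /= unzip1_zip // e.
Qed.

Lemma snd_fzip (u : {fmonom I}) (v : {fmonom J}) :
  fdeg u = fdeg v -> snd_word (fzip u v) = v.
Proof.
by rewrite !fdegE => e; apply/eqP; rewrite fmP /= unzip2_zip // e.
Qed.

Lemma fdeg_fzip n (u : {fmonom I}) (v : {fmonom J}) :
  fdeg u = n -> fdeg v = n -> fdeg (fzip u v) = n.
Proof. by rewrite !fdegE /= size_zip => -> ->; rewrite minnn. Qed.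

Lemma mmul_fzip (u u' : {fmonom I}) (v v' : {fmonom J}) : fdeg u = fdeg v ->
  fzip (mmul u u') (mmul v v') = mmul (fzip u v) (fzip u' v').
Proof. by rewrite !fdegE => e; apply/eqP; rewrite fmP /= !fmM zip_cat. Qed.

Lemma shuffle_words z : shuffle << fst_word z >> << snd_word z >> = << z >> :> TIJ.
Proof. by rewrite shuffleUU fzip_words. Qed.

Lemma shuffle2UU (p : {fmonom I} * {fmonom I}) (q : {fmonom J} * {fmonom J}) :
  shuffle2 (<< p >> : TTI) (<< q >> : TTJ) = << (fzip p.1 q.1, fzip p.2 q.2) >>.
Proof. exact: linext2UU. Qed.

Lemma shuffle2_tens (x y : TI) (x' y' : TJ) :
  shuffle2 (tens x y) (tens x' y') = tens (shuffle x x') (shuffle y y').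
Proof.
move: x y; apply: malg_bilin_ext => [y|x|y|x|u v].
- by move=> c a b; rewrite tensPl shuffle2Pl.
- by move=> c a b; rewrite tensPr shuffle2Pl.
- by move=> c a b; rewrite shufflePl tensPl.
- by move=> c a b; rewrite shufflePl tensPr.
move: x' y'; apply: malg_bilin_ext => [y|x|y|x|u' v'].
- by move=> c a b; rewrite tensPl shuffle2Pr.
- by move=> c a b; rewrite tensPr shuffle2Pr.
- by move=> c a b; rewrite shufflePr tensPl.
- by move=> c a b; rewrite shufflePr tensPr.
by rewrite !tensUU shuffle2UU !shuffleUU tensUU.
Qed.

Lemma bideg_bilin_ext (U : lmodType K) (f g : TTI -> TTJ -> U) r s
    (a : TTI) (b : TTJ) :
  (forall y, linear (f^~ y)) -> (forall x, linear (f x)) ->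
  (forall y, linear (g^~ y)) -> (forall x, linear (g x)) ->
  (forall u v u' v', fdeg u = r -> fdeg v = s -> fdeg u' = r -> fdeg v' = s ->
     f << (u, v) >> << (u', v') >> = g << (u, v) >> << (u', v') >>) ->
  TTdeg r s a -> TTdeg r s b -> f a b = g a b.
Proof.
move=> fl fr gl gr h ha hb.
apply: (lin_eq_in (f := f^~ b) (g := g^~ b)) => // -[u v] /ha[/= ru sv].
apply: (lin_eq_in (f := f _) (g := g _)) => // -[u' v'] /hb[/= ru' sv'].
exact: h.
Qed.

Lemma tmul_shuffle2 r s (a : TTI) (b : TTJ) : TTdeg r s a -> TTdeg r s b ->
  tmul (shuffle2 a b) = shuffle (tmul a) (tmul b).
Proof.
apply: (bideg_bilin_ext (f := fun a b => tmul (shuffle2 a b))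
  (g := fun a b => shuffle (tmul a) (tmul b))).
- by move=> y c x x'; rewrite shuffle2Pl tmulP.
- by move=> y c x x'; rewrite shuffle2Pr tmulP.
- by move=> y c x x'; rewrite tmulP shufflePl.
- by move=> y c x x'; rewrite tmulP shufflePr.
move=> u v u' v' hu hv hu' hv'; rewrite shuffle2UU /= /tmul !linextU /=.
by rewrite shuffleUU mmul_fzip // hu.
Qed.

Lemma shuffle_mul r s (x y : TI) (x' y' : TJ) : Tdeg r x -> Tdeg s y ->
  Tdeg r x' -> Tdeg s y' ->
  shuffle (x * y) (x' * y') = shuffle x x' * shuffle y y'.
Proof.
move=> hx hy hx' hy'; rewrite -(tmul_tens x y) -(tmul_tens x' y').
rewrite -(tmul_shuffle2 (TTdeg_tens hx hy) (TTdeg_tens hx' hy')).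
by rewrite shuffle2_tens tmul_tens.
Qed.

Lemma TTdeg_shuffle2 r s (a : TTI) (b : TTJ) :
  TTdeg r s a -> TTdeg r s b -> TTdeg r s (shuffle2 a b).
Proof.
move=> ha hb.
apply: (lin_in (f := shuffle2^~ b) _ (TTdeg_subspace _ _)) => [|[u v] /ha[/= hu hv]].
  by move=> c x x'; rewrite shuffle2Pl.
apply: (lin_in (f := shuffle2 _) _ (TTdeg_subspace _ _)) => [|[u' v'] /hb[/= hu' hv']].
  by move=> c x x'; rewrite shuffle2Pr.
rewrite shuffle2UU /= -(fdeg_fzip hu hu') -(fdeg_fzip hv hv'); exact: TTdegU.
Qed.

Lemma pairing_shuffle2 r s (a a' : TTI) (b b' : TTJ) : TTdeg r s a ->
  TTdeg r s b -> TTdeg r s a' -> TTdeg r s b' ->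
  pairing (shuffle2 a b) (shuffle2 a' b') = pairing a a' * pairing b b'.
Proof.
move=> ha hb ha' hb'.
apply: (bideg_bilin_ext (U := K^o) (f := fun a b => @pairing K _ (shuffle2 a b) _)
  (g := fun a b => @pairing K _ a _ * @pairing K _ b _) _ _ _ _ _ ha hb).
- by move=> y c x x'; rewrite shuffle2Pl pairingPl.
- by move=> y c x x'; rewrite shuffle2Pr pairingPl.
- by move=> y c x x'; rewrite pairingPl mulrDl -mulrA.
- by move=> y c x x'; rewrite pairingPl mulrDr mulrCA.
move=> u1 v1 u2 v2 hu1 hv1 hu2 hv2.
apply: (bideg_bilin_ext (U := K^o) (f := fun a b => @pairing K _ _ (shuffle2 a b))
  (g := fun a b => @pairing K _ _ a * @pairing K _ _ b) _ _ _ _ _ ha' hb').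
- by move=> y c x x'; rewrite shuffle2Pl pairingPr.
- by move=> y c x x'; rewrite shuffle2Pr pairingPr.
- by move=> y c x x'; rewrite pairingPr mulrDl -mulrA.
- by move=> y c x x'; rewrite pairingPr mulrDr mulrCA.
move=> u3 v3 u4 v4 hu3 hv3 hu4 hv4.
apply: etrans (congr2 (@pairing K _) (shuffle2UU _ _) (shuffle2UU _ _)) _.
rewrite /= !pairingUU.
have zE n (u u' : {fmonom I}) (v v' : {fmonom J}) : fdeg u = n -> fdeg v = n ->
    fdeg u' = n -> fdeg v' = n -> (fzip u v == fzip u' v') = (u == u') && (v == v').
  move=> e1 e2 e3 e4; apply/eqP/andP => [e|[/eqP -> /eqP ->] //].
  have := congr1 snd_word e; have := congr1 fst_word e.
  by rewrite !fst_fzip ?snd_fzip ?e1 ?e2 ?e3 ?e4 // => -> ->.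
by rewrite !xpair_eqE (zE r) // (zE s) // -natrM mulnb andbACA.
Qed.

Section Maps.
Context {psi : TTI -> TTI} {phi : TTJ -> TTJ}.
Implicit Types (z : {fmonom (I * J)%type} * {fmonom (I * J)%type}).

Lemma jmapU z : jmap psi phi << z >> =
  shuffle2 (psi << (fst_word z.1, fst_word z.2) >>)
           (phi << (snd_word z.1, snd_word z.2) >>).
Proof. exact: linextU. Qed.

Lemma jmap_linear : linear (jmap psi phi).
Proof. exact: linext_is_linear. Qed.

(** In bidegree (r, s), j(psi, phi) is psi (x) phi read through [shuffle2].
    The bidegrees have to agree because [fzip] truncates the longer word. *)
Lemma jmap_shuffle2 r s a b : linear psi -> linear phi -> TTdeg r s a ->
  TTdeg r s b -> jmap psi phi (shuffle2 a b) = shuffle2 (psi a) (phi b).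
Proof.
move=> lpsi lphi; have lj := jmap_linear.
apply: (bideg_bilin_ext (f := fun a b => jmap psi phi (shuffle2 a b))
  (g := fun a b => shuffle2 (psi a) (phi b))).
- by move=> y c x x'; rewrite shuffle2Pl lj.
- by move=> y c x x'; rewrite shuffle2Pr lj.
- by move=> y c x x'; rewrite lpsi shuffle2Pl.
- by move=> y c x x'; rewrite lphi shuffle2Pr.
move=> u v u' v' hu hv hu' hv'; rewrite shuffle2UU jmapU /=.
by rewrite !fst_fzip ?snd_fzip ?hu ?hv.
Qed.

Lemma graded_jmap : graded psi -> graded phi -> graded (jmap psi phi).
Proof.
move=> gpsi gphi r s t ht.
apply: (lin_in jmap_linear (TTdeg_subspace _ _)) => -[u v] /ht[/= hu hv].
rewrite jmapU /= -hu -hv; apply: TTdeg_shuffle2.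
  by apply: gpsi; rewrite -(fdeg_fst u) -(fdeg_fst v); apply: TTdegU.
by apply: gphi; rewrite -(fdeg_snd u) -(fdeg_snd v); apply: TTdegU.
Qed.

End Maps.

Lemma bideg_fst (u v : {fmonom (I * J)%type}) :
  TTdeg (fdeg u) (fdeg v) (<< (fst_word u, fst_word v) >> : TTI).
Proof. by rewrite -(fdeg_fst u) -(fdeg_fst v); apply: TTdegU. Qed.

Lemma bideg_snd (u v : {fmonom (I * J)%type}) :
  TTdeg (fdeg u) (fdeg v) (<< (snd_word u, snd_word v) >> : TTJ).
Proof. by rewrite -(fdeg_snd u) -(fdeg_snd v); apply: TTdegU. Qed.

Arguments bideg_fst u v : clear implicits.
Arguments bideg_snd u v : clear implicits.

Lemma shuffle2_words (u v : {fmonom (I * J)%type}) :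
  shuffle2 (<< (fst_word u, fst_word v) >> : TTI)
    (<< (snd_word u, snd_word v) >> : TTJ) = << (u, v) >>.
Proof. by rewrite shuffle2UU /= !fzip_words. Qed.

Lemma jmap_can (psi psi' : TTI -> TTI) (phi phi' : TTJ -> TTJ) :
  C2_inverse psi psi' -> C2_inverse phi phi' ->
  cancel (jmap psi phi) (jmap psi' phi').
Proof.
move=> [lpsi lpsi' K1 _ g _] [lphi lphi' H1 _ h _].
apply: (malg_eq_lin (f := fun t => jmap psi' phi' (jmap psi phi t)) (g := id)) => //.
  by apply: lin_comp; apply: jmap_linear.
move=> [u v]; rewrite jmapU /=.
rewrite (jmap_shuffle2 lpsi' lphi' (g _ _ _ (bideg_fst u v)) (h _ _ _ (bideg_snd u v))).
by rewrite K1 H1 shuffle2_words.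
Qed.

Lemma C2_jmap (psi : TTI -> TTI) (phi : TTJ -> TTJ) :
  C2 psi -> C2 phi -> C2 (jmap psi phi).
Proof.
move=> /C2P[psi' hpsi] /C2P[phi' hphi]; apply/C2P; exists (jmap psi' phi').
have [_ _ _ _ g g'] := hpsi; have [_ _ _ _ h h'] := hphi.
split; try exact: jmap_linear; try exact: graded_jmap; try exact: jmap_can.
by apply: jmap_can; exact: C2_inverse_sym.
Qed.

Section Cocycles.
Context {psi : TTI -> TTI} {phi : TTJ -> TTJ}.

(** The pairing is multiplicative under [shuffle2], so the right-hand side
    preserves it against [jmap psi phi]. *)
Lemma bang_jmap : C2 psi -> C2 phi ->
  bang (jmap psi phi) = jmap (bang psi) (bang phi).
Proof.
move=> Cpsi Cphi; have [Bpsi Bphi] := (C2_bang Cpsi, C2_bang Cphi).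
have Cj := C2_jmap Cpsi Cphi; have Bj := C2_jmap Bpsi Bphi.
apply: (bang_unique Cj); apply: scalar_bilin_ext.
- by move=> y c x x'; rewrite jmap_linear pairingPl.
- by move=> y c x x'; rewrite jmap_linear pairingPr.
- by move=> y c x x'; rewrite pairingPl.
- by move=> y c x x'; rewrite pairingPr.
move=> [u v] [u' v'].
have [h|] := boolP ((fdeg u' != fdeg u) || (fdeg v' != fdeg v)).
  rewrite (pairing_TTdeg0 (TTdegU u v) (TTdegU u' v') h).
  apply: (pairing_TTdeg0 _ _ h); first exact/(C2_TTdeg Bj)/TTdegU.
  exact/(C2_TTdeg Cj)/TTdegU.
rewrite negb_or !negbK => /andP[/eqP hu /eqP hv].
have [a b] := (bideg_fst u v, bideg_snd u v).
have := (bideg_fst u' v', bideg_snd u' v'); rewrite hu hv => -[a' b'].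
rewrite !jmapU /= (pairing_shuffle2 (C2_TTdeg Bpsi a) (C2_TTdeg Bphi b)
  (C2_TTdeg Cpsi a') (C2_TTdeg Cphi b')) !pairing_bang //.
apply: etrans (esym (pairing_shuffle2 a b a' b')) _.
exact (f_equal2 (fun x y => pairing x y) (shuffle2_words u v) (shuffle2_words u' v')).
Qed.

Lemma cochain_shuffle r s (x y : TI) (x' y' : TJ) : C2 psi -> C2 phi ->
  Tdeg r x -> Tdeg s y -> Tdeg r x' -> Tdeg s y' ->
  cochain_mul (jmap psi phi) (shuffle x x') (shuffle y y') =
  shuffle (cochain_mul psi x y) (cochain_mul phi x' y').
Proof.
move=> Cpsi Cphi hx hy hx' hy'; rewrite /cochain_mul -shuffle2_tens.
have [a b] := (TTdeg_tens hx hy, TTdeg_tens hx' hy').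
rewrite (jmap_shuffle2 (C2_linear Cpsi) (C2_linear Cphi) a b).
exact: (tmul_shuffle2 (C2_TTdeg Cpsi a) (C2_TTdeg Cphi b)).
Qed.

Lemma Tdeg_fst (w : {fmonom (I * J)%type}) n : fdeg w = n ->
  Tdeg n (<< fst_word w >> : TI).
Proof. by move=> <-; apply: TdegU_of; apply: fdeg_fst. Qed.

Lemma Tdeg_snd (w : {fmonom (I * J)%type}) n : fdeg w = n ->
  Tdeg n (<< snd_word w >> : TJ).
Proof. by move=> <-; apply: TdegU_of; apply: fdeg_snd. Qed.

(** On words, twisted products of shuffles are shuffles of twisted products,
    so the identity follows from those of [psi] and [phi]. *)
Lemma cocycle_jmap : Z2 psi -> Z2 phi -> cocycle (jmap psi phi).
Proof.
move=> [Cpsi Apsi _] [Cphi Aphi _] r s t.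
have lj := C2_linear (C2_jmap Cpsi Cphi).
have cl y : linear (cochain_mul (jmap psi phi) ^~ y).
  by move=> c a b; rewrite /cochain_mul tensPl lj tmulP.
have cr x : linear (cochain_mul (jmap psi phi) x).
  by move=> c a b; rewrite /cochain_mul tensPr lj tmulP.
have key u v w : fdeg u = r -> fdeg v = s -> fdeg w = t ->
    cochain_mul (jmap psi phi) (cochain_mul (jmap psi phi) << u >> << v >>) << w >> =
    cochain_mul (jmap psi phi) << u >> (cochain_mul (jmap psi phi) << v >> << w >>).
  move=> hu hv hw; rewrite -(shuffle_words u) -(shuffle_words v) -(shuffle_words w).
  have [u1 u2] := (Tdeg_fst hu, Tdeg_snd hu).
  have [v1 v2] := (Tdeg_fst hv, Tdeg_snd hv).
  have [w1 w2] := (Tdeg_fst hw, Tdeg_snd hw).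
  have e1 := cochain_shuffle Cpsi Cphi u1 v1 u2 v2.
  have e2 := cochain_shuffle Cpsi Cphi v1 w1 v2 w2.
  have e3 := cochain_shuffle Cpsi Cphi (C2_cochain_deg Cpsi u1 v1) w1
    (C2_cochain_deg Cphi u2 v2) w2.
  have e4 := cochain_shuffle Cpsi Cphi u1 (C2_cochain_deg Cpsi v1 w1)
    u2 (C2_cochain_deg Cphi v2 w2).
  move: e3; rewrite (Apsi r s t _ _ _ u1 v1 w1) (Aphi r s t _ _ _ u2 v2 w2).
  move=> e3; move: (cochain_mul (jmap psi phi)) e1 e2 e3 e4 => m e1 e2 e3 e4.
  exact: (etrans (congr1 (m^~ _) e1) (etrans e3 (esym (etrans (congr1 (m _) e2) e4)))).
move: (cochain_mul (jmap psi phi)) cl cr key => m cl cr key x y z hx hy hz.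
apply: (lin_eq_in (f := fun x => m (m x y) z) (g := fun x => m x (m y z))) => //.
  by move=> c a b; rewrite !cl.
move=> u /hx hu.
apply: (lin_eq_in (f := fun y => m (m _ y) z) (g := fun y => m _ (m y z))).
- by move=> c a b; rewrite cr cl.
- by move=> c a b; rewrite cl cr.
move=> v /hy hv.
apply: (lin_eq_in (f := fun z => m (m _ _) z) (g := fun z => m _ (m _ z))).
- by move=> c a b; rewrite cr.
- by move=> c a b; rewrite !cr.
by move=> w /hz hw; apply: key.
Qed.

Lemma counital_jmap : Z2 psi -> Z2 phi -> counital (jmap psi phi).
Proof.
move=> [Cpsi _ Upsi] [Cphi _ Uphi] x.
have lj := C2_linear (C2_jmap Cpsi Cphi).
have [lpsi lphi] := (C2_linear Cpsi, C2_linear Cphi).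
have e1 : shuffle (1 : TI) (1 : TJ) = 1.
  have := shuffle_words mone.
  have -> : fst_word mone = mone by apply/eqP; rewrite fmP /= !fm1.
  by have -> : snd_word mone = mone by apply/eqP; rewrite fmP /= !fm1.
split.
  apply: (malg_eq_lin (f := fun x => jmap psi phi (tens 1 x)) (g := tens 1)) x.
  - by move=> c a b; rewrite tensPr lj.
  - by move=> c a b; rewrite tensPr.
  move=> w; rewrite -(shuffle_words w) -e1 -shuffle2_tens.
  have [w1 w2] := (Tdeg_fst (erefl (fdeg w)), Tdeg_snd (erefl (fdeg w))).
  rewrite (jmap_shuffle2 lpsi lphi (TTdeg_tens (Tdeg1 (K := K)) w1)
    (TTdeg_tens (Tdeg1 (K := K)) w2)).
  by rewrite (Upsi _).1 (Uphi _).1.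
apply: (malg_eq_lin (f := fun x => jmap psi phi (tens x 1))
  (g := fun x => tens x (1 : TIJ))) x.
- by move=> c a b; rewrite tensPl lj.
- by move=> c a b; rewrite tensPl.
move=> w; rewrite -(shuffle_words w) -e1 -shuffle2_tens.
have [w1 w2] := (Tdeg_fst (erefl (fdeg w)), Tdeg_snd (erefl (fdeg w))).
rewrite (jmap_shuffle2 lpsi lphi (TTdeg_tens w1 (Tdeg1 (K := K)))
  (TTdeg_tens w2 (Tdeg1 (K := K)))).
by rewrite (Upsi _).2 (Uphi _).2.
Qed.

Lemma Z2_jmap : Z2 psi -> Z2 phi -> Z2 (jmap psi phi).
Proof.
move=> Zpsi Zphi; split; [|exact: cocycle_jmap|exact: counital_jmap].
by case: Zpsi Zphi => [? _ _] [? _ _]; exact: C2_jmap.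
Qed.

End Cocycles.

End Jmap.

(** * Ideals generated by tensor products of subspaces *)

Section ShuffledIdeals.
Context {K : fieldType} {I J : finType}.
Local Notation TI := (tensor_alg K I).
Local Notation TJ := (tensor_alg K J).
Local Notation TIJ := (tensor_alg K (I * J)%type).
Local Notation TTI := (tensor_alg2 K I).
Local Notation TTJ := (tensor_alg2 K J).
Local Notation TTIJ := (tensor_alg2 K (I * J)%type).

Lemma shuffle2_otens l (c y : TI) (c' y' : TJ) :
  shuffle2 (otens l c y) (otens l c' y') = otens l (shuffle c c') (shuffle y y').
Proof. by case: l; rewrite /otens shuffle2_tens. Qed.

Lemma shuffle_sandwich p n r (a x b : TI) (a' x' b' : TJ) :
  Tdeg p a -> Tdeg n x -> Tdeg r b -> Tdeg p a' -> Tdeg n x' -> Tdeg r b' ->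
  shuffle (a * x * b) (a' * x' * b') =
  shuffle a a' * shuffle x x' * shuffle b b'.
Proof.
move=> ha hx hb ha' hx' hb'.
apply: (etrans (shuffle_mul (TdegM ha hx) hb (TdegM ha' hx') hb')).
by rewrite (shuffle_mul ha hx ha' hx').
Qed.

(** The words c, a, b around a shuffle of x and y are themselves shuffles of
    their letters in I and in J. *)
Lemma slab_shuffle l s p r n (X : set TI) (Y : set TJ) :
  X `<=` Tdeg n -> Y `<=` Tdeg n ->
  slab l s p (shuffle_sp X Y) r =
  lspan [set shuffle2 t u | t in slab l s p X r & u in slab l s p Y r].
Proof.
move=> hX hY; set L := lspan [set _ | _ in _ & _ in _].
have sL : subspace L by exact: lspan_subspace.
apply/seteqP; split.
  apply: slabP => // c a z b hc ha hz hb.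
  apply: (lspan_image (f := fun z => otens l c (a * z * b)) _ sL _ hz).
    by move=> k y y'; rewrite malg_mulPr malg_mulPl otensPr.
  move=> _ [x Xx [y Yy <-]].
  apply: (lin_in (f := fun c => otens l c (a * _ * b)) _ sL) => [k t t'|c' /hc hc'].
    by rewrite otensPl.
  apply: (lin_in (f := fun a => otens l _ (a * _ * b)) _ sL) => [k t t'|a' /ha ha'].
    by rewrite 2!malg_mulPl otensPr.
  apply: (lin_in (f := fun b => otens l _ (_ * _ * b)) _ sL) => [k t t'|b' /hb hb'].
    by rewrite malg_mulPr otensPr.
  have [c1 c2] := (Tdeg_fst (K := K) hc', Tdeg_snd (K := K) hc').
  have [a1 a2] := (Tdeg_fst (K := K) ha', Tdeg_snd (K := K) ha').
  have [b1 b2] := (Tdeg_fst (K := K) hb', Tdeg_snd (K := K) hb').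
  have e := shuffle2_otens l << fst_word c' >> (<< fst_word a' >> * x * << fst_word b' >>)
    << snd_word c' >> (<< snd_word a' >> * y * << snd_word b' >>).
  rewrite (shuffle_sandwich a1 (hX _ Xx) b1 a2 (hY _ Yy) b2) in e.
  rewrite (shuffle_words a') (shuffle_words b') (shuffle_words c') in e.
  rewrite /mkset -e; apply: sub_lspan.
  exists (otens l << fst_word c' >> (<< fst_word a' >> * x * << fst_word b' >>)).
    exact: mem_slab.
  exists (otens l << snd_word c' >> (<< snd_word a' >> * y * << snd_word b' >>)) => //.
  exact: mem_slab.
set M := slab _ _ _ _ _; have sM : subspace M by exact: lspan_subspace.
apply: lspan_min => // _ [t ht [u hu <-]].
have l1 := @lspan_image K _ _ (fun t => shuffle2 t u) _ M _ sM _ t ht.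
apply: l1 => [k y y'|_ [c [a [x [b [[hc ha Xx hb] ->]]]]]]; first exact: shuffle2Pl.
have l2 := @lspan_image K _ _ (shuffle2 (otens l c (a * x * b))) _ M _ sM _ u hu.
apply: l2 => [k y y'|_ [c' [a' [x' [b' [[hc' ha' Yx hb'] ->]]]]]].
  exact: shuffle2Pr.
rewrite shuffle2_otens (shuffle_sandwich ha (hX _ Xx) hb ha' (hY _ Yx) hb').
apply: mem_slab; try exact: Tdeg_shuffle.
by apply: sub_lspan; exists x => //; exists x'.
Qed.

Lemma stable_shuffle psi phi n (X : set TI) (Y : set TJ) :
  C2 psi -> C2 phi -> X `<=` Tdeg n -> Y `<=` Tdeg n ->
  stable psi X -> stable phi Y -> stable (jmap psi phi) (shuffle_sp X Y).
Proof.
move=> Cpsi Cphi hX hY sX sY l s p r; rewrite (slab_shuffle _ _ _ _ hX hY).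
set L := lspan _; have sL : subspace L by exact: lspan_subspace.
have lj := C2_linear (C2_jmap Cpsi Cphi).
have jE t u : slab l s p X r t -> slab l s p Y r u ->
    jmap psi phi (shuffle2 t u) = shuffle2 (psi t) (phi u).
  move=> /(slab_deg hX) ht /(slab_deg hY) hu; move: ht hu.
  by rewrite /TTside; case: (l); apply: jmap_shuffle2; exact: C2_linear.
apply/seteqP; split=> [_ [w hw <-]|].
  apply: (lspan_image lj sL _ hw) => _ [t ht [u hu <-]].
  rewrite (jE t u ht hu); apply: sub_lspan.
  exists (psi t); first by rewrite -(sX l s p r); exists t.
  by exists (phi u) => //; rewrite -(sY l s p r); exists u.
apply: lspan_min; first exact: image_linear_subspace.
move=> _ [t ht [u hu <-]].
move: ht hu; rewrite -(sX l s p r) -(sY l s p r) => -[t' ht' <-] [u' hu' <-].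
exists (shuffle2 t' u'); last exact: jE.
by apply: sub_lspan; exists t' => //; exists u'.
Qed.

Section TwistLiftShuffle.
Context {psi : TTI -> TTI} {phi : TTJ -> TTJ} (Zpsi : Z2 psi) (Zphi : Z2 phi).
Local Notation thetaI := (@twist_lift K I psi).
Local Notation thetaJ := (@twist_lift K J phi).
Local Notation thetaIJ := (@twist_lift K (I * J)%type (jmap psi phi)).

(** By induction on n: shuffling is multiplicative on homogeneous factors, for
    the ordinary and for the twisted products, and the generators are fixed. *)
Lemma twist_lift_shuffle n (x : TI) (y : TJ) : Tdeg n x -> Tdeg n y ->
  thetaIJ (shuffle x y) = shuffle (thetaI x) (thetaJ y).
Proof.
have [Cpsi Cphi] : C2 psi /\ C2 phi by case: Zpsi Zphi => [? _ _] [? _ _].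
have Zj := Z2_jmap Zpsi Zphi.
have [lI lJ] := (@twist_lift_linear K I psi, @twist_lift_linear K J phi).
have lIJ := @twist_lift_linear K (I * J)%type (jmap psi phi).
have red : (forall u v, fdeg u = n -> fdeg v = n ->
      thetaIJ (shuffle << u >> << v >>) = shuffle (thetaI << u >>) (thetaJ << v >>)) ->
    Tdeg n x -> Tdeg n y -> thetaIJ (shuffle x y) = shuffle (thetaI x) (thetaJ y).
  move=> h hx hy.
  apply: (lin_eq_in (f := fun x => thetaIJ (shuffle x y))
    (g := fun x => shuffle (thetaI x) (thetaJ y))) => [k t t'|k t t'|u /hx hu].
  - by rewrite shufflePl lIJ.
  - by rewrite lI shufflePl.
  apply: (lin_eq_in (f := fun y => thetaIJ (shuffle << u >> y))
    (g := fun y => shuffle (thetaI << u >>) (thetaJ y))) => [k t t'|k t t'|v /hy hv].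
  - by rewrite shufflePr lIJ.
  - by rewrite lJ shufflePr.
  exact: h.
apply: red => u v; elim: n u v => [|n ih] u v hu hv.
  have -> : u = mone by apply/eqP; rewrite -fdeg_eq0 hu.
  have -> : v = mone by apply/eqP; rewrite -fdeg_eq0 hv.
  rewrite shuffleUU; have -> : fzip (mone : {fmonom I}) (mone : {fmonom J}) = mone.
    by apply/eqP; rewrite fmP /= !fm1.
  rewrite (twist_lift1 (psi := psi)) (twist_lift1 (psi := phi)).
  rewrite (twist_lift1 (psi := jmap psi phi)).
  apply/esym/(etrans (shuffleUU mone mone)); congr << _ >>.
  by apply/eqP; rewrite fmP /= !fm1.
have split1 (L : finType) (w : {fmonom L}) : fdeg w = n.+1 ->
    exists i w', fdeg w' = n /\ w = mmul (fmu i) w'.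
  case: w => [[|i w]] //= [e]; exists i, (FMonom w); split; first by rewrite fdegE.
  by apply/eqP; rewrite fmP fmM fmU.
have [i [u' [hu' ->]]] := split1 _ _ hu.
have [j [v' [hv' ->]]] := split1 _ _ hv.
have di : Tdeg 1 (<< fmu i >> : TI) by apply: TdegU_of; apply: fdegU.
have dj : Tdeg 1 (<< fmu j >> : TJ) by apply: TdegU_of; apply: fdegU.
have [du dv] := (TdegU_of (K := K) hu', TdegU_of (K := K) hv').
have dtu := Tdeg_twist_lift Zpsi du; have dtv := Tdeg_twist_lift Zphi dv.
have eij : thetaIJ (shuffle << fmu i >> << fmu j >>) = shuffle << fmu i >> << fmu j >>.
  rewrite shuffleUU; have -> : fzip (fmu i) (fmu j) = fmu (i, j).
    by apply/eqP; rewrite fmP /= !fmU.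
  exact: (twist_lift_gen Zj).
rewrite -(malg_mulUU (fmu i) u') -(malg_mulUU (fmu j) v').
rewrite (shuffle_mul di du dj dv) (twist_liftM Zj) (twist_liftM Zpsi).
rewrite (twist_liftM Zphi) (twist_lift_gen Zpsi) (twist_lift_gen Zphi).
exact (etrans (f_equal2 (cochain_mul (jmap psi phi)) eij (ih u' v' hu' hv'))
  (cochain_shuffle Cpsi Cphi di dtu dj dtv)).
Qed.

Lemma twist_shuffle_sp n (X' X : set TI) (Y' Y : set TJ) :
  X' `<=` Tdeg n -> Y' `<=` Tdeg n -> thetaI @` X' = X -> thetaJ @` Y' = Y ->
  thetaIJ @` shuffle_sp X' Y' = shuffle_sp X Y.
Proof.
move=> hX hY <- <-; have lt := @twist_lift_linear K _ (jmap psi phi).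
apply/seteqP; split=> [_ [t ht <-]|].
  apply: (lspan_image lt (lspan_subspace _) _ ht) => _ [x Xx [y Yy <-]].
  rewrite (twist_lift_shuffle (hX _ Xx) (hY _ Yy)); apply: sub_lspan.
  by exists (thetaI x); [exists x|exists (thetaJ y) => //; exists y].
apply: lspan_min; first by apply: image_linear_subspace => //; exact: lspan_subspace.
move=> _ [_ [x Xx <-] [_ [y Yy <-] <-]].
exists (shuffle x y); last exact: (twist_lift_shuffle (hX _ Xx) (hY _ Yy)).
by apply: sub_lspan; exists x => //; exists y.
Qed.

(** The common form of the five formulas, with X n and Y n homogeneous parts
    of ideals or their annihilators. *)
Lemma eq_twist_shuffle (C D : qspace K (I * J)%type) (P : set nat)
    (X' X : nat -> set TI) (Y' Y : nat -> set TJ) :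
  (forall n, X' n `<=` Tdeg n) -> (forall n, X n `<=` Tdeg n) ->
  (forall n, Y' n `<=` Tdeg n) -> (forall n, Y n `<=` Tdeg n) ->
  (forall n, stable psi (X n)) -> (forall n, stable phi (Y n)) ->
  (forall n, thetaI @` X' n = X n) -> (forall n, thetaJ @` Y' n = Y n) ->
  qideal C = ideal_gen (\bigcup_(n in P) shuffle_sp (X' n) (Y' n)) ->
  qideal D = ideal_gen (\bigcup_(n in P) shuffle_sp (X n) (Y n)) ->
  eq_twist C D (jmap psi phi).
Proof.
move=> dX' dX dY' dY sX sY eX eY.
have [Cpsi Cphi] : C2 psi /\ C2 phi by case: Zpsi Zphi => [? _ _] [? _ _].
apply: (eq_twist_generated (Z2_jmap Zpsi Zphi)) => n _.
  exact: (stable_shuffle Cpsi Cphi (dX n) (dY n)).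
exact: (twist_shuffle_sp (dX' n) (dY' n)).
Qed.

End TwistLiftShuffle.

End ShuffledIdeals.

(** * Ideals generated in a single degree *)

Section Mth.
Context {K : fieldType} {I : finType}.

Lemma mth_hideal m (A : qspace K I) :
  mth m A -> qideal A = ideal_gen (\bigcup_(n in [set m]) hideal A n).
Proof.
move=> [_ [X [sX hX eA]]]; rewrite bigcup_set1; apply/seteqP; split.
  move=> x; rewrite eA => hx; apply: hx; split; first exact: ideal_gen_ideal.
  move=> y Xy; apply: sub_ideal_gen; split; last exact: hX.
  by rewrite eA; apply: sub_ideal_gen.
move=> x; apply; split; first exact: qideal_ideal.
by move=> y [].
Qed.

End Mth.

Lemma bullet_qideal (K : fieldType) (I J : finType) m (A : conic_qspace K I)
    (B : conic_qspace K J) :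
  qideal (bullet m A B) =
  ideal_gen (\bigcup_(n in [set m]) shuffle_sp (hideal A n) (hideal B n)).
Proof. by rewrite bigcup_set1; exact: qideal_quot. Qed.

(** The degree m part of an ideal generated in degree m is stable, so
    [eq_twist_generated] applies to it alone. *)
Lemma mth_conic_twist (K : fieldType) (I : finType) (A : conic_qspace K I)
    (psi : tensor_alg2 K I -> tensor_alg2 K I) (Zpsi : Z2 psi)
    (Apsi : admissible2 A psi) m :
  mth m A -> mth m (conic_twist Zpsi Apsi).
Proof.
move=> hm; have [m2 _] := hm; split=> //.
pose X n := hideal (conic_twist Zpsi Apsi) n.
exists (X m); split.
- split; first by split; [case: (qideal_subspace (conic_twist Zpsi Apsi))
    |case: (@Tdeg_subspace K I m)].
  move=> c x y [hx nx] [hy ny]; split.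
    by case: (qideal_subspace (conic_twist Zpsi Apsi)) => _; apply.
  by case: (@Tdeg_subspace K I m) => _; apply.
- by move=> x [].
have iX : conic_ideal (ideal_gen (X m)).
  by apply: ideal_gen_conic => x [_ hx]; exists m.
have eX : qideal (quot_qspace iX) = ideal_gen (\bigcup_(n in [set m]) X n).
  by rewrite bigcup_set1 qideal_quot.
have [Zp [Dp e]] := eq_twist_generated Zpsi
  (fun n _ => admissible2_stable n Apsi) (fun n _ => twist_hideal Zpsi _ n)
  eX (mth_hideal hm).
have cE x : Defs.canon (conic_twist Zpsi Apsi) x = Defs.canon A (@twist_lift K I psi x).
  exact: (canon_twist Zpsi _ x).
rewrite -(qideal_quot iX) e; apply: funext => x.
by rewrite /qideal /mkset cE (canon_twist Zp Dp).
Qed.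

Theorem theorem16 (R : realType) (k : scalars) (I J : finType)
    (A : conic_qspace (base_field R k) I) (B : conic_qspace (base_field R k) J)
    (psi : tensor_alg2 (base_field R k) I -> tensor_alg2 (base_field R k) I)
    (phi : tensor_alg2 (base_field R k) J -> tensor_alg2 (base_field R k) J)
    (Zpsi : Z2 psi) (Zphi : Z2 phi)
    (Apsi : admissible2 A psi) (Bphi : admissible2 B phi) :
  let A_psi := conic_twist Zpsi Apsi in
  let B_phi := conic_twist Zphi Bphi in
  [/\ eq_twist (odot A_psi B_phi) (odot A B) (jmap psi phi),
      eq_twist (triangler A_psi B_phi) (triangler A B) (jmap (bang psi) phi),
      eq_twist (trianglel A_psi B_phi) (trianglel A B) (jmap psi (bang phi)),
      eq_twist (diamond A_psi B_phi) (diamond A B) (bang (jmap psi phi))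
    & forall m : nat, mth m A -> mth m B ->
        [/\ mth m A_psi, mth m B_phi
          & eq_twist (bullet m A_psi B_phi) (bullet m A B) (jmap psi phi)]].
Proof.
move=> A_psi B_phi.
have [Zb_psi Zb_phi] := (Z2_bang Zpsi, Z2_bang Zphi).
have [Cpsi Cphi] : C2 psi /\ C2 phi by split; [case: (Zpsi)|case: (Zphi)].
have sA n : stable psi (hideal A n) := admissible2_stable n Apsi.
have sB n : stable phi (hideal B n) := admissible2_stable n Bphi.
have tA n := twist_hideal Zpsi
  (admissible2_admissible (conic_prop A) (Z2_linear Zpsi) Apsi) n.
have tB n := twist_hideal Zphi
  (admissible2_admissible (conic_prop B) (Z2_linear Zphi) Bphi) n.
have sA' n : stable (bang psi) (annihilator n (hideal A n)).
  exact: (stable_bang Cpsi (@hideal_deg _ _ A n) (sA n)).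
have sB' n : stable (bang phi) (annihilator n (hideal B n)).
  exact: (stable_bang Cphi (@hideal_deg _ _ B n) (sB n)).
have tA' n := twist_annihilator n Zpsi (tA n).
have tB' n := twist_annihilator n Zphi (tB n).
split.
- apply: (eq_twist_shuffle (P := setT) Zpsi Zphi _ _ _ _ sA sB tA tB);
    try (by move=> n; exact: hideal_deg).
    rewrite -ideal_gen_sumsp -/(odot_ideal A_psi B_phi) -odot_ideal_gen.
    exact: qideal_quot.
  rewrite -ideal_gen_sumsp -/(odot_ideal A B) -odot_ideal_gen.
  exact: qideal_quot.
- apply: (eq_twist_shuffle (P := setT) Zb_psi Zphi _ _ _ _ sA' sB tA' tB);
    try (by move=> n; first [exact: hideal_deg|exact: annihilator_deg]);
    by rewrite -ideal_gen_sumsp; exact: qideal_quot.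
- apply: (eq_twist_shuffle (P := setT) Zpsi Zb_phi _ _ _ _ sA sB' tA tB');
    try (by move=> n; first [exact: hideal_deg|exact: annihilator_deg]);
    by rewrite -ideal_gen_sumsp; exact: qideal_quot.
- rewrite (bang_jmap Cpsi Cphi).
  apply: (eq_twist_shuffle (P := setT) Zb_psi Zb_phi _ _ _ _ sA' sB' tA' tB');
    try (by move=> n; exact: annihilator_deg);
    by rewrite -ideal_gen_sumsp; exact: qideal_quot.
move=> m mA mB; split; [exact: mth_conic_twist|exact: mth_conic_twist|].
apply: (eq_twist_shuffle (P := [set m]) Zpsi Zphi _ _ _ _ sA sB tA tB);
  try (by move=> n; exact: hideal_deg); exact: bullet_qideal.
Qed.
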